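(* Let $$\lambda_1=-\frac{i\sqrt{6\sqrt5-10}}{2},\quad \lambda_2=\frac{i\sqrt{6\sqrt5-10}}{2},\quad \lambda_3=-\frac{\sqrt{6\sqrt5+10}}{2},\quad \lambda_4=\frac{\sqrt{6\sqrt5+10}}{2},$$ and consider the linear differential system over $\mathbb{C}(\tau)$ $$\tau^{-5}\,\frac{dV}{d\tau}=\begin{pmatrix}\lambda_1+3\tau^{-6}&-\tau^{-6}&0&0\\-\tau^{-6}&\lambda_2+3\tau^{-6}&0&0\\0&0&\lambda_3+3\tau^{-6}&-\tau^{-6}\\0&0&-\tau^{-6}&\lambda_4+3\tau^{-6}\end{pmatrix}V.$$ Let $G_1$ be its differential Galois group. Then the connected component $(G_1)^0$ of the unit element of $G_1$ is a direct product of two groups $SL_2(\mathbb{C})$, i.e. $(G_1)^0=SL_2(\mathbb{C})\times SL_2(\mathbb{C})$.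
   Context: The differential Galois group is that of a Picard--Vessiot extension of the base differential field $(\mathbb{C}(\tau),d/d\tau)$ for the system, viewed as a linear algebraic group over $\mathbb{C}$; the connected component is taken in the Zariski topology. *)

(* Defs.v *)
From HB Require Import structures.
From mathcomp Require Import all_boot all_order all_algebra.
From mathcomp Require Import generic_quotient fraction.
From mathcomp Require Import boolp classical_sets reals.
From mathcomp Require Import topology.
From mathcomp.real_closed Require Import complex.
From mathcomp.multinomials Require Import -(notations) mpoly.
From mathcomp Require Import ring.

Set Implicit Arguments.
Unset Strict Implicit.
Unset Printing Implicit Defensive.

Import GRing.Theory Num.Theory.

Local Open Scope ring_scope.
Local Open Scope quotient_scope.
Local Open Scope classical_set_scope.

Record derivation (K : fieldType) := Derivation {
  der_fun :> K -> K;
  derD : forall x y, der_fun (x + y) = der_fun x + der_fun y;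
  derM : forall x y, der_fun (x * y) = der_fun x * y + x * der_fun y }.

Fact quotient_ruleD (K : fieldType) (a b c d a' b' c' d' : K) :
  b != 0 -> d != 0 ->
  ((a' * d + a * d' + (c' * b + c * b')) * (b * d) -
   (a * d + c * b) * (b' * d + b * d')) / (b * d) ^+ 2 =
  (a' * b - a * b') / b ^+ 2 + (c' * d - c * d') / d ^+ 2.
Proof. by move=> b0 d0; field; rewrite b0 d0. Qed.

Fact quotient_ruleM (K : fieldType) (a b c d a' b' c' d' : K) :
  b != 0 -> d != 0 ->
  ((a' * c + a * c') * (b * d) - (a * c) * (b' * d + b * d')) / (b * d) ^+ 2 =
  (a' * b - a * b') / b ^+ 2 * (c / d) + a / b * ((c' * d - c * d') / d ^+ 2).
Proof. by move=> b0 d0; field; rewrite b0 d0. Qed.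

Section RationalFunctions.
Variable C : fieldType.

(* The field C(tau), as the fraction field of C[tau]. *)
Definition ratfun := {fraction {poly C}}.

Definition ratfun_tau : ratfun := tofrac 'X.

Definition ratfun_cst (c : C) : ratfun := tofrac c%:P.

(* d/dtau, by the quotient rule on the chosen representative of the fraction;
   [ratfun_der_fracE] shows that the representative is irrelevant. *)
Definition ratfun_der_fun (x : ratfun) : ratfun :=
  let p := \n_(repr x) in let q := \d_(repr x) in
  tofrac (p^`() * q - p * q^`()) / tofrac q ^+ 2.

Lemma ratfun_numdenE (x : ratfun) :
  x = tofrac \n_(repr x) / tofrac \d_(repr x).
Proof.
rewrite -[x in LHS]reprK; move: (repr x) => r.
have dN0 := denom_ratioP r.
apply: (@mulIf _ (tofrac \d_r)); first by rewrite tofrac_eq0.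
rewrite divfK ?tofrac_eq0 //; unlock tofrac; rewrite -[LHS]FracField.pi_mul.
apply/eqmodP; rewrite /= FracField.equivfE /FracField.mulf /=.
by rewrite !numden_Ratio ?mulf_neq0 ?oner_neq0 // !mulr1 mulrC.
Qed.

Lemma ratfun_der_fracE (p q : {poly C}) : q != 0 ->
  ratfun_der_fun (tofrac p / tofrac q) =
  tofrac (p^`() * q - p * q^`()) / tofrac q ^+ 2.
Proof.
move=> q0; rewrite /ratfun_der_fun.
set x : ratfun := tofrac p / tofrac q.
have := ratfun_numdenE x; have := denom_ratioP (repr x).
set a := \n_(repr x); set b := \d_(repr x) => b0 /eqP.
rewrite /x eqr_div ?tofrac_eq0 // -!rmorphM /= tofrac_eq => /eqP e.
have e' := congr1 deriv e; rewrite !derivM in e'.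
apply/eqP; rewrite eqr_div ?expf_neq0 ?tofrac_eq0 // -!rmorphXn -!rmorphM /=.
rewrite tofrac_eq; apply/eqP.
move: e e'; set a' := a^`(); set b' := b^`(); set p' := p^`(); set q' := q^`().
move=> e e'.
have -> : (a' * b - a * b') * q ^+ 2 = b * q * (a' * q + a * q')
   - b * q' * (a * q) - b' * q * (a * q) by ring.
rewrite -e -e'; ring.
Qed.

Fact ratfun_derD x y :
  ratfun_der_fun (x + y) = ratfun_der_fun x + ratfun_der_fun y.
Proof.
rewrite (ratfun_numdenE x) (ratfun_numdenE y).
have := denom_ratioP (repr x); have := denom_ratioP (repr y).
move: \n_(repr x) \d_(repr x) \n_(repr y) \d_(repr y) => a b c d d0 b0.
have [b1 d1] : tofrac b != 0 /\ tofrac d != 0 by rewrite !tofrac_eq0.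
rewrite (addf_div _ _ b1 d1) -!tofracM -tofracD.
rewrite (ratfun_der_fracE _ (mulf_neq0 b0 d0)).
rewrite (ratfun_der_fracE _ b0) (ratfun_der_fracE _ d0).
rewrite !derivD !derivM !(tofracB, tofracD, tofracM).
exact: quotient_ruleD b1 d1.
Qed.

Fact ratfun_derM x y :
  ratfun_der_fun (x * y) = ratfun_der_fun x * y + x * ratfun_der_fun y.
Proof.
rewrite (ratfun_numdenE x) (ratfun_numdenE y).
have := denom_ratioP (repr x); have := denom_ratioP (repr y).
move: \n_(repr x) \d_(repr x) \n_(repr y) \d_(repr y) => a b c d d0 b0.
have [b1 d1] : tofrac b != 0 /\ tofrac d != 0 by rewrite !tofrac_eq0.
rewrite mulf_div -!tofracM (ratfun_der_fracE _ (mulf_neq0 b0 d0)).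
rewrite (ratfun_der_fracE _ b0) (ratfun_der_fracE _ d0).
rewrite !derivM !(tofracB, tofracD, tofracM).
exact: quotient_ruleM b1 d1.
Qed.

Definition ratfun_der : derivation ratfun := Derivation ratfun_derD ratfun_derM.

Lemma ratfun_der_poly (p : {poly C}) : ratfun_der (tofrac p) = tofrac p^`().
Proof.
have := @ratfun_der_fracE p 1 (oner_neq0 _).
by rewrite derivC mulr0 subr0 mulr1 rmorph1 expr1n !divr1.
Qed.

End RationalFunctions.

(* (L, dL) is a Picard-Vessiot extension of (K, dK), via iota, for the system
   Y' = A Y, and F is a fundamental matrix of solutions with entries in L. *)
Record picard_vessiot (K : fieldType) (dK : derivation K) (n : nat)
    (A : 'M[K]_n) (L : fieldType) (dL : derivation L)
    (iota : {rmorphism K -> L}) (F : 'M[L]_n) : Prop := PicardVessiot {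
  pv_der : forall a, dL (iota a) = iota (dK a);
  pv_cst : forall x, dL x = 0 -> exists2 a, dK a = 0 & x = iota a;
  pv_unit : F \in unitmx;
  pv_sol : map_mx dL F = map_mx iota A *m F;
  pv_gen : forall S : {pred L}, divring_closed S ->
    (forall a, iota a \in S) -> (forall i j, F i j \in S) ->
    forall x, x \in S }.

Record diff_automorphism (K L : fieldType) (dL : derivation L)
    (iota : {rmorphism K -> L}) (sigma : {rmorphism L -> L}) : Prop :=
  DiffAutomorphism {
    da_bij : bijective sigma;
    da_der : forall x, sigma (dL x) = dL (sigma x);
    da_fix : forall a, sigma (iota a) = iota a }.

(* The differential Galois group over C(tau), as a subgroup of GL_n(C): sigma is
   identified with the constant matrix M such that sigma(F) = F M. *)
Definition diff_galois_group (C L : fieldType) (dL : derivation L)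
    (iota : {rmorphism ratfun C -> L}) (n : nat) (F : 'M[L]_n) : set 'M[C]_n :=
  [set M | exists2 sigma : {rmorphism L -> L},
     diff_automorphism dL iota sigma &
     map_mx sigma F = F *m map_mx (fun c => iota (ratfun_cst c)) M].

Section Zariski.
Variables (C : fieldType) (n : nat).

Definition mxeval (p : mpoly (n * n) C) (M : 'M[C]_n) : C :=
  meval (fun k => mxvec M 0 k) p.

Fact mxevalM p q M : mxeval (p * q) M = mxeval p M * mxeval q M.
Proof. exact: rmorphM. Qed.

Definition zero_locus (S : set (mpoly (n * n) C)) : set 'M[C]_n :=
  [set M | forall p, S p -> mxeval p M = 0].

(* An alias of 'M[C]_n carrying the Zariski topology. *)
Definition zariski_mx := 'M[C]_n.

Definition zariski_open (U : set zariski_mx) : Prop :=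
  exists S, U = ~` zero_locus S.

Fact zariski_openT : zariski_open setT.
Proof.
exists [set 1]; rewrite -setC0; congr (~` _); apply/esym/seteqP; split=> // M /=.
by move=> /(_ _ erefl) /eqP; rewrite /mxeval rmorph1 oner_eq0.
Qed.

Fact zariski_openI : setI_closed zariski_open.
Proof.
move=> _ _ [S ->] [T ->].
exists [set r | exists p q, [/\ S p, T q & r = p * q]].
rewrite -setCU; congr (~` _); apply/seteqP; split=> M /=.
  by move=> [] h _ [p] [q] [Sp Tq ->]; rewrite mxevalM;
    [rewrite (h p Sp) mul0r|rewrite (h q Tq) mulr0].
move=> h; apply: contrapT => /not_orP[/existsNP[p /not_implyP[Sp p0]]].
move=> /existsNP[q /not_implyP[Tq q0]].
have /eqP : mxeval (p * q) M = 0 by apply: h; exists p, q.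
by rewrite mxevalM mulf_eq0 => /orP[]/eqP.
Qed.

Fact zariski_open_bigU (I : Type) (f : I -> set zariski_mx) :
  (forall i, zariski_open (f i)) -> zariski_open (\bigcup_i f i).
Proof.
move=> /choice[S fE]; exists (\bigcup_i S i).
rewrite (eq_bigcupr (fun i _ => fE i)) -setC_bigcap; congr (~` _).
apply/seteqP; split=> M /= h; first by move=> p [i _ Sp]; apply: (h i).
by move=> i _ p Sp; apply: h; exists i.
Qed.

HB.instance Definition _ := Choice.on zariski_mx.
HB.instance Definition _ := isOpenTopological.Build zariski_mx
  zariski_openT zariski_openI zariski_open_bigU.

Lemma zariski_closedP (A : set zariski_mx) :
  closed A <-> exists S, A = zero_locus S.
Proof.
rewrite -openC; split=> [[S /(congr1 setC)]|[S ->]]; last by exists S.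
by rewrite !setCK => ->; exists S.
Qed.

Definition identity_component (G : set 'M[C]_n) : set 'M[C]_n :=
  connected_component (G : set zariski_mx) (1%:M : zariski_mx).

(* Restrictions to G of elements of the coordinate ring
   C[x_ij, 1/det] of GL_n. *)
Definition regular_on (G : set 'M[C]_n) (f : 'M[C]_n -> C) : Prop :=
  exists (p : mpoly (n * n) C) (k : nat),
    forall M, G M -> f M = mxeval p M / (\det M) ^+ k.

End Zariski.

Record alg_group_morphism (C : fieldType) (m n : nat)
    (G : set 'M[C]_m) (H : set 'M[C]_n) (f : 'M[C]_m -> 'M[C]_n) : Prop :=
  AlgGroupMorphism {
    agm_maps : forall M, G M -> H (f M);
    agm_mul : forall M N, G M -> G N -> f (M *m N) = f M *m f N;
    agm_reg : forall i j, regular_on G (fun M => f M i j) }.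

Definition alg_group_iso (C : fieldType) (m n : nat)
    (G : set 'M[C]_m) (H : set 'M[C]_n) : Prop :=
  exists (f : 'M[C]_m -> 'M[C]_n) (g : 'M[C]_n -> 'M[C]_m),
    [/\ alg_group_morphism G H f, alg_group_morphism H G g,
        forall M, G M -> g (f M) = M & forall N, H N -> f (g N) = N].

Definition SL (C : fieldType) (n : nat) : set 'M[C]_n := [set M | \det M = 1].

(* The direct product of two linear groups, embedded block-diagonally. *)
Definition group_prod (C : fieldType) (m n : nat)
    (G : set 'M[C]_m) (H : set 'M[C]_n) : set 'M[C]_(m + n) :=
  [set block_mx M 0 0 N | M in G & N in H].

Section System.
Variable R : realType.
Local Notation C := R[i].
Local Notation K := (ratfun C).

Definition lambda1 : C := Complex 0 (- (Num.sqrt (6 * Num.sqrt 5 - 10) / 2)).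
Definition lambda2 : C := Complex 0 (Num.sqrt (6 * Num.sqrt 5 - 10) / 2).
Definition lambda3 : C := Complex (- (Num.sqrt (6 * Num.sqrt 5 + 10) / 2)) 0.
Definition lambda4 : C := Complex (Num.sqrt (6 * Num.sqrt 5 + 10) / 2) 0.

Definition system_mx : 'M[K]_4 :=
  let t : K := ratfun_tau C in
  let s : K := t ^- 6 in
  let l := @ratfun_cst C in
  \matrix_(i < 4, j < 4) nth 0 (nth [::]
    [:: [:: l lambda1 + 3 * s; - s; 0; 0];
        [:: - s; l lambda2 + 3 * s; 0; 0];
        [:: 0; 0; l lambda3 + 3 * s; - s];
        [:: 0; 0; - s; l lambda4 + 3 * s]] i) j.

End System.

(* Main.v *)
From HB Require Import structures.
Require Import Defs.
From mathcomp Require Import all_boot all_order all_algebra.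
From mathcomp Require Import generic_quotient fraction.
From mathcomp Require Import boolp classical_sets reals topology.
From mathcomp.real_closed Require Import complex mxtens.
From mathcomp.multinomials Require Import -(notations) mpoly.
From mathcomp Require Import ring lra zify.

(* Put theta = tau d/dtau. After the gauge F -> tau^-3 F, which does not change
   the Galois group, the system is a pair of Bessel-type 2x2 systems with
   parameters lambda2 and lambda4, so that up to conjugation the Galois group
   lies in SL2 x SL2; equality means that the ideal I of polynomial relations
   between the entries of F over C(tau) is invariant under SL2 x SL2.

   I is stable under theta. Over C((1/tau)) each block is diagonalised by a formal
   gauge transformation, with eigenvalues l and -l for l = lambda tau^6 up to
   terms without pole; since no nonzero Laurent series has a logarithmic
   derivative with a pole, and since lambda2 and lambda4 are linearly
   independent over Z, I is homogeneous for the two-dimensional torus of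
   exponentials. Hence I is stable under left multiplication by an infinitesimal
   generator S of each of the two factors of that torus. The entries of S are
   combinations of the hypergeometric series 3F0(1/2, -1/6, 1/6) and its first
   two derivatives, which are linearly independent over C(tau); therefore I,
   being defined over C(tau), is stable under all of sl2 x sl2, hence under
   SL2 x SL2. *)

Set Implicit Arguments.
Unset Strict Implicit.
Unset Printing Implicit Defensive.

Import Order.TTheory GRing.Theory Num.Theory.

Local Open Scope ring_scope.

(** * Tensor powers of matrices *)

(** The Picard-Vessiot field L and the field of Laurent series are never embedded in a common field.
    A relation has coefficients in K = C(tau), so the relations of a fixed degree form a
    finite-dimensional K-space: F, with entries in L, defines this space, and the formal gauge over
    Laurent series constrains it. The symmetry so obtained is a left multiplication, whereas a
    Galois matrix M acts by F -> F M. The identity F M = (F M F^-1) F reconciles the two; its left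
    factor has entries in L, which is why invariance is proved for SL2 over L and not only over the
    constants. The generator S = (a, b; c, -a) is the formal solution of theta S = [A, S] with S^2 =
    1, where A is the matrix of a block. Eliminating b and c leaves a third-order equation for a,
    that is a recursion of step 12 in the exponent of t = 1/tau. The numerator of its ratio has the
    three roots -1/2, 1/6, -1/6, exactly enough to kill the quadratic polynomials in the exponent
    that come from a, theta a and theta^2 a. Only nilpotent elements of sl2 are integrated, so the
    one-parameter groups are polynomial. *)

Fixpoint tdim (n d : nat) : nat := if d is d'.+1 then (n * tdim n d')%N else 1%N.

Section TensorPower.
Variables (R : comPzRingType) (n : nat).
Implicit Types (g h X Y : 'M[R]_n).

(** The entries are the products of d entries of g, so linear forms in them are the forms of degree
    d in g. The recursion is that of [tdim], which keeps the sizes convertible. *)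
Fixpoint tpow g d : 'M[R]_(tdim n d) :=
  if d is d'.+1 then g *t tpow g d' else 1%:M.

(* The derivative of [tpow] at [g] in the direction [X]. *)
Fixpoint tder g X d : 'M[R]_(tdim n d) :=
  if d is d'.+1 then X *t tpow g d' + g *t tder g X d' else 0.

(** Weights of a diagonal torus element on the d-th tensor power: a basis tensor gets the sum of the
    weights of its factors. *)
Fixpoint tweight (w : 'rV[R]_n) d : 'rV[R]_(tdim n d) :=
  if d is d'.+1 then
    \row_k (w 0 (mxtens_unindex k).1 + tweight w d' 0 (mxtens_unindex k).2)
  else 0.

Lemma tensmxDr m p q r (A : 'M[R]_(m, p)) (B C : 'M_(q, r)) :
  A *t (B + C) = A *t B + A *t C.
Proof. by apply/matrixP=> i j; rewrite !mxE mulrDr. Qed.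

Lemma tensmxDl m p q r (A B : 'M[R]_(m, p)) (C : 'M_(q, r)) :
  (A + B) *t C = A *t C + B *t C.
Proof. by apply/matrixP=> i j; rewrite !mxE mulrDl. Qed.

Lemma tensmxZr m p q r a (A : 'M[R]_(m, p)) (B : 'M_(q, r)) :
  A *t (a *: B) = a *: (A *t B).
Proof. by apply/matrixP=> i j; rewrite !mxE mulrCA. Qed.

Lemma tensmxZl m p q r a (A : 'M[R]_(m, p)) (B : 'M_(q, r)) :
  (a *: A) *t B = a *: (A *t B).
Proof. by apply/matrixP=> i j; rewrite !mxE mulrA. Qed.

Lemma tens_diag_mx m p (v : 'rV[R]_m) (w : 'rV[R]_p) :
  diag_mx v *t diag_mx w =
  diag_mx (\row_k (v 0 (mxtens_unindex k).1 * w 0 (mxtens_unindex k).2)).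
Proof.
apply/matrixP=> i j; case: (mxtens_indexP i) => i0 i1.
case: (mxtens_indexP j) => j0 j1; rewrite tensmxE !mxE mxtens_indexK /=.
rewrite (can_eq (@mxtens_indexK _ _)) -pair_eqE /pair_eq /=.
by case: eqP => _; case: eqP => _; rewrite ?mulr1n ?mulr0n ?mulr0 ?mul0r.
Qed.

Lemma tens1mx1 m p : (1%:M : 'M[R]_m) *t (1%:M : 'M[R]_p) = 1%:M.
Proof.
rewrite -!diag_const_mx tens_diag_mx; congr diag_mx.
by apply/rowP=> k; rewrite !mxE mulr1.
Qed.

Lemma tpow1 d : tpow 1%:M d = 1%:M.
Proof. by elim: d => //= d ->; rewrite tens1mx1. Qed.

Lemma tpowM g h d : tpow (g *m h) d = tpow g d *m tpow h d.
Proof. by elim: d => [|d IH] /=; rewrite ?mulmx1 // tensmx_mul IH. Qed.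

Lemma tder_mulr g X h d : tder g X d *m tpow h d = tder (g *m h) (X *m h) d.
Proof.
elim: d => [|d IH] /=; first by rewrite mul0mx.
by rewrite mulmxDl !tensmx_mul IH tpowM.
Qed.

Lemma tder_mull g X h d : tpow h d *m tder g X d = tder (h *m g) (h *m X) d.
Proof.
elim: d => [|d IH] /=; first by rewrite mulmx0.
by rewrite mulmxDr !tensmx_mul IH tpowM.
Qed.

Lemma tderD g X Y d : tder g (X + Y) d = tder g X d + tder g Y d.
Proof.
elim: d => [|d IH] /=; first by rewrite addr0.
by rewrite IH tensmxDl tensmxDr addrACA.
Qed.

Lemma tderZ g a X d : tder g (a *: X) d = a *: tder g X d.
Proof.
elim: d => [|d IH] /=; first by rewrite scaler0.
by rewrite IH tensmxZl tensmxZr scalerDr.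
Qed.

Lemma tder_diag (w : 'rV[R]_n) d : tder 1%:M (diag_mx w) d = diag_mx (tweight w d).
Proof.
elim: d => [|d IH] /=; first by rewrite linear0.
rewrite IH tpow1 -!diag_const_mx !tens_diag_mx -linearD /=; congr diag_mx.
by apply/rowP=> k; rewrite !mxE mulr1 mul1r.
Qed.

Lemma tweightD v w d : tweight (v + w) d = tweight v d + tweight w d.
Proof.
elim: d => [|d IH] /=; first by rewrite addr0.
by rewrite IH; apply/rowP=> k; rewrite !mxE addrACA.
Qed.

Lemma tweightZ a v d : tweight (a *: v) d = a *: tweight v d.
Proof.
elim: d => [|d IH] /=; first by rewrite scaler0.
by rewrite IH; apply/rowP=> k; rewrite !mxE mulrDr.
Qed.

(** Each coordinate is a sum of coordinates of w. This serves both for integrality and for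
    regularity of weights. *)
Lemma tweight_closed (S : R -> Prop) (w : 'rV[R]_n) d :
  S 0 -> (forall x y, S x -> S y -> S (x + y)) -> (forall i, S (w 0 i)) ->
  forall k, S (tweight w d 0 k).
Proof.
move=> S0 SD Sw; elim: d => [|d IH] k /=; rewrite mxE //.
by apply: SD.
Qed.

Section Derivation.
Variable D : R -> R.
Hypothesis DD : forall x y, D (x + y) = D x + D y.
Hypothesis DM : forall x y, D (x * y) = D x * y + x * D y.

Lemma der_zero : D 0 = 0.
Proof. by apply: (addrI (D 0)); rewrite -DD !addr0. Qed.

Lemma der_one : D 1 = 0.
Proof. by apply: (addrI (D 1)); rewrite addr0 -{3}(mulr1 1) DM mulr1 mul1r. Qed.

Lemma map_der_sum (I : Type) (r : seq I) (P : pred I) (f : I -> R) :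
  D (\sum_(i <- r | P i) f i) = \sum_(i <- r | P i) D (f i).
Proof. exact: (big_morph D DD der_zero). Qed.

Lemma map_derM m p q (A : 'M[R]_(m, p)) (B : 'M_(p, q)) :
  map_mx D (A *m B) = map_mx D A *m B + A *m map_mx D B.
Proof.
apply/matrixP=> i j; rewrite !mxE map_der_sum -big_split /=.
by apply: eq_bigr => k _; rewrite !mxE DM.
Qed.

Lemma map_der1 m : map_mx D (1%:M : 'M[R]_m) = 0.
Proof.
apply/matrixP=> i j; rewrite !mxE.
by case: eqP => _; rewrite ?mulr1n ?der_one // mulr0n der_zero.
Qed.

Lemma map_der_tpow g d : map_mx D (tpow g d) = tder g (map_mx D g) d.
Proof.
elim: d => [|d IH] /=; first by rewrite map_der1.
by rewrite -IH; apply/matrixP=> i j; rewrite !mxE DM.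
Qed.

End Derivation.
End TensorPower.

Lemma map_tpow (R S : comPzRingType) (f : {rmorphism R -> S}) n (g : 'M[R]_n) d :
  map_mx f (tpow g d) = tpow (map_mx f g) d.
Proof.
elim: d => [|d IH] /=; first by rewrite map_mx1.
by rewrite -IH; apply/matrixP=> i j; rewrite !mxE rmorphM.
Qed.

Lemma map_tder (R S : comPzRingType) (f : {rmorphism R -> S}) n
    (g X : 'M[R]_n) d :
  map_mx f (tder g X d) = tder (map_mx f g) (map_mx f X) d.
Proof.
elim: d => [|d IH] /=; first by rewrite map_mx0.
rewrite -IH -map_tpow; apply/matrixP=> i j.
by rewrite !mxE rmorphD !rmorphM.
Qed.

(** * Relations between solutions and the formal torus *)

(* Reducing a basis of [U] to echelon form, an entry in column [k] of the row
   with pivot [i] solves [c' = (w i - w k) c]. *)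
Lemma graded_submx (K : fieldType) (dK : derivation K) r N (U : 'M[K]_(r, N))
    (w om : 'rV[K]_N) :
  (forall i k, om 0 i != om 0 k ->
     forall c, dK c = (w 0 i - w 0 k) * c -> c = 0) ->
  ((map_mx dK U + U *m diag_mx w)%R <= U)%MS -> (U *m diag_mx om <= U)%MS.
Proof.
move=> noexp stU; set V := row_base U.
have VU : (V :=: U)%MS by exact: eq_row_base.
have fV : row_full V^T by rewrite /row_full mxrank_tr; exact: row_base_free.
set f := fullrankfun fV.
have uV : colsub f V \in unitmx.
  rewrite -unitmx_tr -row_full_unit.
  have -> : (colsub f V)^T = rowsub f V^T by apply/matrixP=> i k; rewrite !mxE.
  exact: fullrowsub_full.
set W := invmx (colsub f V) *m V.
have WU : (W :=: U)%MS.
  apply: (eqmx_trans _ VU); apply: eqmxMfull.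
  by rewrite row_full_unit unitmx_inv.
have W1 : colsub f W = 1%:M.
  rewrite -(mulVmx uV); apply/matrixP=> i k; rewrite !mxE.
  by apply: eq_bigr => l _; rewrite !mxE.
have [P WP] : exists P, W = P *m U by apply/submxP; rewrite WU.
have : ((map_mx dK W + W *m diag_mx w)%R <= W)%MS.
  rewrite WU.
  rewrite WP (map_derM (@derD _ dK) (@derM _ dK)) -addrA -mulmxA -mulmxDr.
  by rewrite addmx_sub ?submxMl // (submx_trans _ stU) // submxMl.
case/submxP=> B BE.
(* The pivot columns of [W] form the identity matrix, whose derivative is zero; reading [BE] in
   these columns determines [B]. *)
have BD : B = diag_mx (\row_i w 0 (f i)).
  have /matrixP E := congr1 (colsub f) BE.
  apply/matrixP=> i k; have := E i k; rewrite !mxE.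
  have -> : \sum_l B i l * W l (f k) = B i k.
    rewrite (bigD1 k) //= big1 ?addr0 => [|l lk].
      by have /matrixP /(_ k k) := W1; rewrite !mxE eqxx => ->; rewrite mulr1.
    have /matrixP /(_ l k) := W1; rewrite !mxE (negPf lk) => ->.
    by rewrite mulr0.
  have /matrixP /(_ i k) := W1; rewrite !mxE => ->.
  have -> : dK (i == k)%:R = 0.
    case: (i == k); first exact: (der_one (@derM _ dK)).
    exact: (der_zero (@derD _ dK)).
  rewrite (bigD1 (f k)) //= big1 ?addr0 => [<-|l lk].
    have /matrixP /(_ i k) := W1; rewrite !mxE => ->.
    rewrite add0r eqxx mulr1n; case: eqP => [->|_]; first by rewrite mul1r.
    by rewrite mul0r.
  by rewrite !mxE (negPf lk) mulr0n mulr0.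
have grW : W *m diag_mx om = diag_mx (\row_i om 0 (f i)) *m W.
  apply/matrixP=> i k; rewrite mul_mx_diag mul_diag_mx !mxE.
  have [->|ne] := eqVneq (om 0 k) (om 0 (f i)); first by rewrite mulrC.
  have /matrixP /(_ i k) := BE; rewrite BD mul_diag_mx mul_mx_diag !mxE => e.
  suff -> : \sum_j invmx (colsub f V) i j * V j k = 0 by rewrite mul0r mulr0.
  rewrite eq_sym in ne; apply: (noexp _ _ ne).
  move: e; set x := \sum_j _ => e.
  by rewrite mulrBl -e [x * _]mulrC addrK.
have [Q UQ] : exists Q, U = Q *m W by apply/submxP; rewrite WU.
by rewrite {1}UQ -mulmxA grW mulmxA (submx_trans (submxMl _ _)) // WU.
Qed.

(** * Right multiplication of coefficient matrices as a linear map *)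

Section RightMultiplication.
Variables (R : comNzRingType) (m : nat).

(** Acts on the row [mxvec c]: a space of coefficient matrices c becomes a row space, to which the
    inclusion order on row spaces applies. *)
Definition rmul (B : 'M[R]_m) : 'M[R]_(m * m) := lin_mulmxr B.

Lemma rmulP c B : mxvec c *m rmul B = mxvec (c *m B).
Proof. by rewrite mul_vec_lin. Qed.

Lemma rmul_inj (A B : 'M[R]_(m * m)) :
  (forall c, mxvec c *m A = mxvec c *m B) -> A = B.
Proof.
move=> e; apply/row_matrixP=> i; rewrite !rowE.
by rewrite -[delta_mx 0 i]vec_mxK e.
Qed.

Lemma rmul1 : rmul 1%:M = 1%:M.
Proof. by apply: rmul_inj => c; rewrite rmulP !mulmx1. Qed.

Lemma rmulM A B : rmul (A *m B) = rmul A *m rmul B.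
Proof. by apply: rmul_inj => c; rewrite mulmxA !rmulP mulmxA. Qed.

Lemma rmulD A B : rmul (A + B) = rmul A + rmul B.
Proof. by apply: rmul_inj => c; rewrite mulmxDr !rmulP mulmxDr linearD. Qed.

Lemma rmulZ a B : rmul (a *: B) = a *: rmul B.
Proof. by apply: rmul_inj => c; rewrite -scalemxAr !rmulP -scalemxAr linearZ. Qed.

Lemma rmul_diag (w : 'rV[R]_m) :
  rmul (diag_mx w) = diag_mx (mxvec (\matrix_(i, k) w 0 k)).
Proof.
apply: rmul_inj => c; rewrite rmulP !mul_mx_diag; apply/rowP=> l.
by case/mxvec_indexP: l => i k; rewrite !mxE !mxvecE !mxE.
Qed.

Lemma rmulE B i k i' k' :
  rmul B (mxvec_index i k) (mxvec_index i' k') = B k k' *+ (i == i').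
Proof.
have := rmulP (delta_mx i k) B.
rewrite mxvec_delta -rowE => /rowP /(_ (mxvec_index i' k')).
rewrite mxE mxvecE => ->; rewrite mxE (bigD1 k) //= big1 => [|l lk].
  by rewrite mxE eqxx andbT addr0 mulr_natl eq_sym.
by rewrite mxE (negPf lk) andbF mul0r.
Qed.

Lemma map_rmulD (D : R -> R) B : D 0 = 0 -> map_mx D (rmul B) = rmul (map_mx D B).
Proof.
move=> D0; apply/matrixP=> p q; case/mxvec_indexP: p => i k.
case/mxvec_indexP: q => i' k'; rewrite mxE !rmulE mxE.
by case: eqP => _; rewrite ?mulr0n ?mulr1n.
Qed.

End RightMultiplication.

Lemma map_rmul (R S : comNzRingType) (f : {rmorphism R -> S}) m (B : 'M[R]_m) :
  map_mx f (rmul B) = rmul (map_mx f B).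
Proof.
apply/matrixP=> p q; case/mxvec_indexP: p => i k.
case/mxvec_indexP: q => i' k'; rewrite mxE !rmulE mxE.
by rewrite rmorphMn.
Qed.

(** L may have infinite dimension over K, so [phi] has no matrix whose kernel could be taken.
    Instead [U] is a subspace of maximal rank on which [phi] vanishes; adding any further vector of
    the kernel cannot increase the rank. *)
Lemma kernel_mxE (K L : fieldType) (io : {rmorphism K -> L}) N
    (phi : 'rV[K]_N -> L) :
  (forall a u v, phi (a *: u + v) = io a * phi u + phi v) ->
  exists U : 'M[K]_N, forall v, (v <= U)%MS <-> phi v = 0.
Proof.
move=> lin.
have phi0 : phi 0 = 0.
  have := lin 0 0 0; rewrite scaler0 addr0 rmorph0 mul0r add0r => e.
  have := lin 1 0 0; rewrite scaler0 addr0 rmorph1 mul1r => e2.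
  by apply: (addrI (phi 0)); rewrite addr0 -e2.
have phiD u v : phi (u + v) = phi u + phi v.
  by rewrite -[u in LHS]scale1r lin rmorph1 mul1r.
have phiZ a u : phi (a *: u) = io a * phi u 
  by have := lin a u 0; rewrite addr0 phi0 addr0.
pose P r := `[< exists U : 'M[K]_N,
  \rank U = r /\ forall v : 'rV_N, (v <= U)%MS -> phi v = 0 >].
have exP : exists r, P r.
  exists 0%N; apply/asboolP; exists 0; split; first by rewrite mxrank0.
  by move=> v; rewrite submx0 => /eqP->.
have ubP r : P r -> (r <= N)%N by move=> /asboolP[U [<- _]]; exact: rank_leq_row.
case: (ex_maxnP exP ubP) => r /asboolP[U [rU UP]] maxr.
exists U => v; split; [exact: UP|move=> v0].
have /maxr : P (\rank (U + v)%MS).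
  apply/asboolP; exists (U + v)%MS; split=> // u /sub_addsmxP[[a b] ->] /=.
  rewrite phiD UP ?submxMl // add0r (mx11_scalar b) mul_scalar_mx phiZ v0.
  by rewrite mulr0.
rewrite -rU (geq_leqif (mxrank_leqif_sup (addsmxSl U v))).
exact: submx_trans (addsmxSr U v).
Qed.

(** * From the formal torus to infinitesimal symmetries over K *)

Section TorusInvariance.
Variables (K Kh L : fieldType).
Variables (dK : derivation K) (dKh : derivation Kh) (dL : derivation L).
Variables (j : {rmorphism K -> Kh}) (io : {rmorphism K -> L}).
Hypothesis j_der : forall x, dKh (j x) = j (dK x).
Hypothesis io_der : forall x, dL (io x) = io (dK x).
Variables (n : nat) (M : 'M[K]_n) (F : 'M[L]_n).
Hypothesis solF : map_mx dL F = map_mx io M *m F.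

(* [c] stands for a polynomial of degree [d] in the entries of a matrix [X],
   with value [\tr (c *m tpow X d)]. *)
Definition relation d (c : 'M[K]_(tdim n d)) : Prop :=
  \tr (map_mx io c *m tpow F d) = 0.

(** Differentiate the relation and replace the derivative of F by M F: the derivative of [tpow F d]
    is then [tder 1%:M M d] times [tpow F d]. *)
Lemma relation_der d (c : 'M[K]_(tdim n d)) :
  relation c -> relation (map_mx dK c + c *m tder 1%:M M d).
Proof.
rewrite /relation => /(congr1 dL).
rewrite (der_zero (@derD _ dL)) => e; rewrite -[RHS]e /mxtrace.
rewrite (map_der_sum (@derD _ dL)); apply: eq_bigr => i _.
have := map_derM (@derD _ dL) (@derM _ dL) (map_mx io c) (tpow F d).
move/matrixP/(_ i i); rewrite [LHS]mxE => ->.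
rewrite (map_der_tpow (@derD _ dL) (@derM _ dL)) solF.
have -> : map_mx dL (map_mx io c) = map_mx io (map_mx dK c).
  by apply/matrixP=> k l; rewrite !mxE io_der.
rewrite map_mxD map_mxM map_tder map_mx1 mulmxDl -mulmxA tder_mulr mul1mx.
by [].
Qed.

Variables (H : 'M[Kh]_n) (w om : 'rV[Kh]_n).
Hypothesis uH : H \in unitmx.
Hypothesis derH : map_mx dKh H = map_mx j M *m H - H *m diag_mx w.
Variables (r : nat) (a : 'I_r -> Kh) (s : 'I_r -> 'M[K]_n).
Hypothesis sH : (\sum_i a i *: map_mx j (s i)) *m H = H *m diag_mx om.
Hypothesis a_free : forall x : 'I_r -> K,
  \sum_i a i * j (x i) = 0 -> forall i, x i = 0.
Hypothesis noexp : forall d i k,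
  tweight om d 0 i != tweight om d 0 k ->
  forall c, dKh c = (tweight w d 0 i - tweight w d 0 k) * c -> c = 0.

(** The K-space of relations is stable under the derivation, hence over Kh under the torus
    generator, a combination of the [s i] with coefficients [a i]. As the space is defined over K
    and the [a i] are independent over K, each [s i] preserves it separately. *)
Lemma relation_torus d (c : 'M[K]_(tdim n d)) i :
  relation c -> relation (c *m tder 1%:M (s i) d).
Proof.
move=> rc; pose phi v := \tr (map_mx io (vec_mx v) *m tpow F d).
have phi_lin b u v : phi (b *: u + v) = io b * phi u + phi v.
  by rewrite /phi linearP /= map_mxD map_mxZ mulmxDl -scalemxAl linearP.
have [U UP] := kernel_mxE phi_lin.
have UE e : (mxvec e <= U)%MS <-> relation e by rewrite UP /phi mxvecK.
suff stU : (U *m rmul (tder 1%:M (s i) d) <= U)%MS.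
  rewrite -UE -rmulP; move/UE in rc.
  by rewrite (submx_trans _ stU) // submxMr.
have derU : ((map_mx dK U + U *m rmul (tder 1%:M M d))%R <= U)%MS.
  apply/row_subP=> k; rewrite linearD /= row_mul.
  have -> : row k (map_mx dK U) = mxvec (map_mx dK (vec_mx (row k U))).
    by rewrite map_vec_mx map_row vec_mxK.
  rewrite -{2}[row k U]vec_mxK rmulP -linearD UE; apply: relation_der.
  by apply/UE; rewrite vec_mxK row_sub.
have mapdj p q (A : 'M[K]_(p, q)) :
    map_mx dKh (map_mx j A) = map_mx j (map_mx dK A).
  by apply/matrixP=> k l; rewrite !mxE j_der.
(* Transport by the gauge [H]: on [V] the connection becomes diagonal with weights [tweight w d], so
   [graded_submx] applies. *)
set T := rmul (tpow H d); set V := map_mx j U *m T.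
have [UU UUE] := submxP derU.
have derV : ((map_mx dKh V
    + V *m diag_mx (mxvec (\matrix_(i, k) tweight w d 0 k)))%R <= V)%MS.
  rewrite -rmul_diag -tder_diag (map_derM (@derD _ dKh) (@derM _ dKh)) mapdj.
  rewrite /T (map_rmulD _ (der_zero (@derD _ dKh))).
  rewrite (map_der_tpow (@derD _ dKh) (@derM _ dKh)) derH.
  rewrite /V /T -mulmxA -rmulM tder_mull mulmx1 -addrA -mulmxDr -rmulD -tderD.
  rewrite subrK -[H in tder H]mul1mx -tder_mulr rmulM mulmxA -mulmxDl.
  rewrite -(map_mx1 j) -map_tder -map_rmul -map_mxM -map_mxD UUE map_mxM -mulmxA.
  exact: submxMl.
have := graded_submx _ derV.
move=> /(_ (mxvec (\matrix_(i, k) tweight om d 0 k))) => grV.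
have {}grV : (V *m rmul (diag_mx (tweight om d)) <= V)%MS.
  rewrite rmul_diag; apply: grV => p q.
  case/mxvec_indexP: p => p p'; case/mxvec_indexP: q => q q'.
  by rewrite !mxvecE !mxE; exact: noexp.
have uT : T *m rmul (tpow (invmx H) d) = 1%:M.
  by rewrite -rmulM -tpowM mulmxV // tpow1 rmul1.
have {grV} : (map_mx j U *m rmul (\sum_k a k *: map_mx j (tder 1%:M (s k) d))
    <= map_mx j U)%MS.
  move: grV; rewrite -tder_diag /V /T -mulmxA -rmulM tder_mull mulmx1 -sH.
  rewrite -{1}[H in tder H]mul1mx -tder_mulr rmulM mulmxA -/T.
  have -> : tder 1%:M (\sum_k a k *: map_mx j (s k)) d =
      \sum_k a k *: map_mx j (tder 1%:M (s k) d).
    elim/big_ind2: _ => [|x x' y y' <- <-|k _].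
    - by rewrite -[X in tder _ X](scale0r (1%:M)) tderZ scale0r.
    - by rewrite tderD.
    - by rewrite tderZ map_tder map_mx1.
  move=> /(submxMr (rmul (tpow (invmx H) d))).
  by rewrite -!mulmxA uT !mulmx1.
(* The cokernel of [U] has entries in K, so stability over Kh is a system of equations whose
   unknowns multiply the [a k] and lie in K; [a_free] then splits it. *)
rewrite submxE -map_cokermx => /eqP e.
rewrite submxE; apply/eqP/matrixP=> p q; rewrite [RHS]mxE.
apply: (a_free (x := fun k => (U *m rmul (tder 1%:M (s k) d) *m cokermx U) p q)).
move/matrixP/(_ p q): e; rewrite [RHS]mxE; apply: etrans.
have -> : rmul (\sum_k a k *: map_mx j (tder 1%:M (s k) d)) =
    \sum_k a k *: map_mx j (rmul (tder 1%:M (s k) d)).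
  elim/big_ind2: _ => [|x x' y y' <- <-|k _].
  - by rewrite -(scale0r (1%:M)) rmulZ scale0r.
  - by rewrite rmulD.
  - by rewrite rmulZ map_rmul.
rewrite mulmx_sumr mulmx_suml summxE; apply: eq_bigr => k _.
by rewrite -scalemxAr -scalemxAl -!map_mxM !mxE.
Qed.

End TorusInvariance.

(** * Integration of a nilpotent symmetry *)

Section UnipotentInvariance.
Variables (K L : fieldType) (io : {rmorphism K -> L}) (n d : nat).
Hypothesis charL : [pchar L] =i pred0.
Variable P : 'M[K]_(tdim n d) -> Prop.
Variable s : 'M[K]_n.
Hypothesis ss0 : s *m s = 0.
Hypothesis Ps : forall c, P c -> P (c *m tder 1%:M s d).
Variable X : 'M[L]_n.
Hypothesis P0 : forall c, P c -> \tr (map_mx io c *m tpow X d) = 0.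

(* The polynomial [p_c(t) = \tr (c *m tpow ((1 + t s) X) d)] vanishes at 0 and
   its derivative is [p_(c *m tder 1 s d)]. *)
Lemma relation_unipotent t c : P c ->
  \tr (map_mx io c *m tpow ((1%:M + t *: map_mx io s) *m X) d) = 0.
Proof.
pose s1 := map_mx polyC (map_mx io s).
pose g : 'M[{poly L}]_n := 1%:M + 'X *: s1.
pose p c := \tr (map_mx polyC (map_mx io c) *m tpow g d
                  *m map_mx polyC (tpow X d)).
have dC m q (A : 'M[L]_(m, q)) : map_mx deriv (map_mx polyC A) = 0.
  by apply/matrixP=> i k; rewrite !mxE derivC.
have dg : map_mx deriv g = s1.
  apply/matrixP=> i k; rewrite !mxE derivD derivM derivX derivC mulr0 addr0 mul1r.
  by case: eqP => _; rewrite ?derivC ?deriv0 add0r.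
(* Because s has square zero, g = 1 + X s is the exponential of X s and s g = s. Hence
   differentiating [tpow g d] amounts to multiplying it on the left by [tder 1%:M s1 d]. *)
have s1g : s1 *m g = s1.
  rewrite mulmxDr mulmx1 -scalemxAr -!map_mxM ss0 !map_mx0 scaler0 addr0.
  by [].
have dp e : (p e)^`() = p (e *m tder 1%:M s d).
  rewrite /p /mxtrace (map_der_sum (@derivD L)); apply: eq_bigr => i _.
  have := map_derM (@derivD L) (@derivM L)
    (map_mx polyC (map_mx io e) *m tpow g d) (map_mx polyC (tpow X d)).
  move/matrixP/(_ i i); rewrite [LHS]mxE => ->.
  rewrite dC mulmx0 addr0 (map_derM (@derivD L) (@derivM L)) dC mul0mx add0r.
  rewrite (map_der_tpow (@derivD L) (@derivM L)) dg.
  by rewrite !map_mxM !map_tder !map_mx1 -(mulmxA _ _ (tpow g d)) tder_mulr mul1mx s1g.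
have pE e u : (p e).[u] =
    \tr (map_mx io e *m tpow ((1%:M + u *: map_mx io s) *m X) d).
  rewrite /p -horner_evalE -trace_map_mx !map_mxM tpowM mulmxA map_tpow.
  have mC m q (A : 'M[L]_(m, q)) : map_mx (horner_eval u) (map_mx polyC A) = A.
    by apply/matrixP=> i k; rewrite !mxE /= horner_evalE hornerC.
  rewrite !mC; congr (\tr (_ *m tpow _ _ *m _)).
  rewrite /g map_mxD map_mx1 map_mxZ mC; congr (_ + _ *: _).
  by rewrite /= horner_evalE hornerX.
(* Induction on the size: the derivative is the polynomial of another element of [P], of smaller
   size, hence zero. In characteristic 0 the polynomial is then constant, and it vanishes at 0. *)
have p0 e : P e -> p e = 0.
  have [m] := ubnP (size (p e)); elim: m => // m IH in e *.
  rewrite ltnS => sz Pe.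
  have e0 : (p e).[0] = 0 by rewrite pE scale0r addr0 mul1mx P0.
  have d0 : (p e)^`() = 0.
    have [->|nz] := eqVneq (p e) 0; first exact: deriv0.
    rewrite dp; apply: IH; last exact: Ps.
    by rewrite -dp (leq_trans (lt_size_deriv nz)).
  have sz1 : (size (p e) <= 1)%N.
    rewrite leqNgt; apply/negP => lt.
    have := congr1 (fun q : {poly L} => q`_(size (p e)).-2) d0.
    rewrite coef0 coef_deriv prednK; last by case: (size _) lt => [|[]].
    move/eqP; rewrite -mulr_natr mulf_eq0 -lead_coefE lead_coef_eq0.
    rewrite ((pcharf0P L).1 charL) -size_poly_eq0.
    by case: (size (p e)) lt => [|[]].
  by rewrite (size1_polyC sz1) -horner_coef0 e0.
by move=> Pc; rewrite -pE p0 // horner0.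
Qed.

End UnipotentInvariance.

(** * Formal expansions at infinity *)

Definition powser (C : fieldType) : Type := nat -> C.

Section PowerSeriesRing.
Variable C : fieldType.
Local Notation PS := (powser C).
Implicit Types (f g h : PS) (p q : {poly C}).

HB.instance Definition _ := gen_eqMixin PS.
HB.instance Definition _ := gen_choiceMixin PS.

Definition ps_add f g : PS := fun n => f n + g n.
Definition ps_opp f : PS := fun n => - f n.
Definition ps_poly p : PS := fun n => p`_n.
Definition ps_mul f g : PS := fun n => \sum_(i < n.+1) f i * g (n - i)%N.

Fact ps_addA : associative ps_add.
Proof. by move=> f g h; apply/funext=> n; exact: addrA. Qed.
Fact ps_addC : commutative ps_add.
Proof. by move=> f g; apply/funext=> n; exact: addrC. Qed.
Fact ps_add0 : left_id (ps_poly 0) ps_add.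
Proof. by move=> f; apply/funext=> n; rewrite /ps_add /ps_poly coef0 add0r. Qed.
Fact ps_addN : left_inverse (ps_poly 0) ps_opp ps_add.
Proof.
by move=> f; apply/funext=> n; rewrite /ps_add /ps_opp /ps_poly coef0 addNr.
Qed.

HB.instance Definition _ := GRing.isZmodule.Build PS
  ps_addA ps_addC ps_add0 ps_addN.

(* The coefficient of degree [n] of a product only depends on the truncations
   of the factors, so the ring laws are inherited from polynomials. *)
Definition ps_trunc n f : {poly C} := \poly_(i < n.+1) f i.

Definition agree n f p := forall i, (i <= n)%N -> f i = p`_i.

Fact ps_truncP n f : agree n f (ps_trunc n f).
Proof. by move=> i le; rewrite coef_poly ltnS le. Qed.

Fact agree_mul n f g p q :
  agree n f p -> agree n g q -> agree n (ps_mul f g) (p * q).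
Proof.
move=> fp gq i le; rewrite /ps_mul coefM; apply: eq_bigr => k _.
by rewrite fp ?gq // (leq_trans _ le) // ?leq_subr // -ltnS.
Qed.

Fact agree_add n f g p q :
  agree n f p -> agree n g q -> agree n (ps_add f g) (p + q).
Proof. by move=> fp gq i le; rewrite /ps_add coefD fp // gq. Qed.

Fact ps_mulA : associative ps_mul.
Proof.
move=> f g h; apply/funext=> n; have T := @ps_truncP n.
rewrite (agree_mul (T f) (agree_mul (T g) (T h))) //.
by rewrite (agree_mul (agree_mul (T f) (T g)) (T h)) // mulrA.
Qed.
Fact ps_mulC : commutative ps_mul.
Proof.
move=> f g; apply/funext=> n; have T := @ps_truncP n.
by rewrite (agree_mul (T f) (T g)) // (agree_mul (T g) (T f)) // mulrC.
Qed.
Fact ps_mul1 : left_id (ps_poly 1) ps_mul.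
Proof.
move=> f; apply/funext=> n; have T := @ps_truncP n.
have o : agree n (ps_poly 1) 1 by [].
by rewrite (agree_mul o (T f)) // mul1r -T.
Qed.
Fact ps_mulD : left_distributive ps_mul ps_add.
Proof.
move=> f g h; apply/funext=> n; have T := @ps_truncP n.
rewrite (agree_mul (agree_add (T f) (T g)) (T h)) // mulrDl.
by rewrite (agree_add (agree_mul (T f) (T h)) (agree_mul (T g) (T h))).
Qed.
Fact ps_1neq0 : ps_poly 1 != 0 :> PS.
Proof.
apply/eqP=> /(congr1 (@^~ 0%N)); change (ps_poly 1 0%N = ps_poly 0 0%N -> False).
by rewrite /ps_poly coef1 coef0 => /eqP; rewrite oner_eq0.
Qed.

HB.instance Definition _ := GRing.Zmodule_isComNzRing.Build PS
  ps_mulA ps_mulC ps_mul1 ps_mulD ps_1neq0.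

Fact ps_poly_zmod : zmod_morphism ps_poly.
Proof. by move=> p q; apply/funext=> n; rewrite /ps_poly coefB. Qed.
Fact ps_poly_monoid : monoid_morphism ps_poly.
Proof.
split=> // p q; apply/funext=> n.
by rewrite {1}/ps_poly; apply/esym; apply: (@agree_mul n _ _ p q).
Qed.
HB.instance Definition _ := GRing.isZmodMorphism.Build {poly C} PS ps_poly
  ps_poly_zmod.
HB.instance Definition _ := GRing.isMonoidMorphism.Build {poly C} PS ps_poly
  ps_poly_monoid.

Lemma ps_polyE p n : ps_poly p n = p`_n. Proof. by []. Qed.

Lemma ps_addE f g n : (f + g) n = f n + g n. Proof. by []. Qed.
Lemma ps_oppE f n : (- f) n = - f n. Proof. by []. Qed.
Lemma ps_mulE f g n : (f * g) n = \sum_(i < n.+1) f i * g (n - i)%N.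
Proof. by []. Qed.
Lemma ps_0E n : (0 : PS) n = 0. Proof. exact: coef0. Qed.
Lemma ps_mul0E f g : (f * g) 0%N = f 0%N * g 0%N.
Proof. by rewrite ps_mulE big_ord1. Qed.

Lemma ps_CmulE c f n : (ps_poly c%:P * f) n = c * f n.
Proof.
rewrite -[LHS]/(ps_mul _ _ n) (@agree_mul n _ _ c%:P (ps_trunc n f)) //; last exact: ps_truncP.
by rewrite coefCM -ps_truncP.
Qed.

Lemma ps_XnmulE m f n :
  (ps_poly 'X^m * f) n = if (n < m)%N then 0 else f (n - m)%N.
Proof.
rewrite -[LHS]/(ps_mul _ _ n) (@agree_mul n _ _ 'X^m (ps_trunc n f)) //; last exact: ps_truncP.
by rewrite coefXnM; case: ltnP => // _; rewrite -ps_truncP // leq_subr.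
Qed.

Lemma ps_1E n : (1 : PS) n = (1 : {poly C})`_n. Proof. by []. Qed.
Lemma ps_natE k n : (k%:R : PS) n = (k%:R)%:P`_n.
Proof. by rewrite -ps_polyE polyC_natr rmorph_nat. Qed.

Lemma ps_order f : f != 0 -> exists m g, f = ps_poly 'X^m * g /\ g 0%N != 0.
Proof.
move=> f0; have : exists n, f n != 0.
  apply: contrapT => /forallNP h; case/eqP: f0; apply/funext=> n.
  by rewrite ps_0E; exact/eqP/negPn/negP/h.
move=> ex; case: (ex_minnP ex) => m fm min; exists m, (fun n => f (n + m)%N).
split; last by rewrite add0n.
apply/funext=> n; rewrite ps_XnmulE; case: ltnP => [lt|le]; last by rewrite subnK.
by have [//|/min] := eqVneq (f n) 0; rewrite leqNgt lt.
Qed.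

Definition ps_unit : pred PS := fun f => `[< exists g, g * f = 1 >].
Definition ps_inv f : PS :=
  if pselect (exists g, g * f = 1) is left e then sval (cid e) else f.

Fact ps_mulVf : {in ps_unit, left_inverse 1 ps_inv *%R}.
Proof.
move=> f /asboolP e; rewrite /ps_inv; case: pselect => // {}e.
exact: svalP (cid e).
Qed.
Fact ps_unitP f g : g * f = 1 -> ps_unit f.
Proof. by move=> e; apply/asboolP; exists g. Qed.
Fact ps_inv_out : {in [predC ps_unit], ps_inv =1 id}.
Proof. by move=> f /asboolPn e; rewrite /ps_inv; case: pselect. Qed.
HB.instance Definition _ := GRing.ComNzRing_hasMulInverse.Build PS
  ps_mulVf ps_unitP ps_inv_out.

Fact ps_integral f g : f * g = 0 -> (f == 0) || (g == 0).
Proof.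
move=> fg; apply/contraT; rewrite negb_or => /andP[/ps_order[m [f1 [fE f10]]]].
move=> /ps_order[l [g1 [gE g10]]]; move: fg.
rewrite fE gE mulrACA -rmorphM -exprD => /(congr1 (@^~ (m + l)%N)) /=.
rewrite ps_XnmulE ltnn subnn ps_mul0E ps_0E => /eqP.
by rewrite mulf_eq0 (negPf f10) (negPf g10).
Qed.
HB.instance Definition _ := GRing.ComUnitRing_isIntegral.Build PS ps_integral.

(* [- t d/dt], which is [tau d/dtau] for [tau = 1/t]. *)
Definition ps_theta f : PS := fun n => - (n%:R * f n).

Lemma ps_thetaD f g : ps_theta (f + g) = ps_theta f + ps_theta g.
Proof. by apply/funext=> n; rewrite /ps_theta !ps_addE mulrDr opprD. Qed.

Lemma ps_thetaM f g : ps_theta (f * g) = ps_theta f * g + f * ps_theta g.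
Proof.
apply/funext=> n; rewrite ps_addE {1}/ps_theta !ps_mulE mulr_sumr -sumrN.
rewrite -big_split /=; apply: eq_bigr => i _; rewrite /ps_theta.
rewrite mulNr mulrN -opprD; congr (- _).
rewrite [f i * (_ * _)]mulrCA -mulrA -mulrDl -natrD subnKC //.
by rewrite -ltnS.
Qed.

Lemma ps_theta_poly p : ps_theta (ps_poly p) = ps_poly (- ('X * p^`())).
Proof.
apply/funext=> n; rewrite /ps_theta !ps_polyE coefN coefXM coef_deriv.
by case: n => [|n] /=; rewrite ?mul0r // mulr_natl.
Qed.

End PowerSeriesRing.

Section DerivationTheory.
Variables (K : fieldType) (D : derivation K).

Lemma der0 : D 0 = 0. Proof. exact: der_zero (@derD _ D). Qed.
Lemma der1 : D 1 = 0. Proof. exact: der_one (@derM _ D). Qed.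
Lemma derN x : D (- x) = - D x.
Proof. by apply/eqP; rewrite -addr_eq0 -derD addNr der0. Qed.
Lemma derB x y : D (x - y) = D x - D y.
Proof. by rewrite derD derN. Qed.

Lemma der_div x y : y != 0 -> D (x / y) = (D x * y - x * D y) / y ^+ 2.
Proof.
move=> y0; have := derM D (x / y) y; rewrite divfK // => ->.
by rewrite mulrDl; field.
Qed.

Lemma derXn x n : D (x ^+ n) = n%:R * x ^+ n.-1 * D x.
Proof.
elim: n => [|[|n] IH]; first by rewrite expr0 der1 !mul0r.
  by rewrite expr1 expr0 !mul1r.
by rewrite exprS derM IH /= -[n.+2]addn1 natrD !exprS; ring.
Qed.

Fact scale_derD (a : K) x y : a * D (x + y) = a * D x + a * D y.
Proof. by rewrite derD mulrDr. Qed.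
Fact scale_derM (a : K) x y : a * D (x * y) = a * D x * y + x * (a * D y).
Proof. by rewrite derM mulrDr mulrA mulrCA. Qed.
Definition scale_der (a : K) : derivation K :=
  Derivation (scale_derD a) (scale_derM a).

End DerivationTheory.

(** * Extension of derivations and injective morphisms to fraction fields *)

Section FractionField.
Local Open Scope quotient_scope.

Lemma frac_numdenE (A : idomainType) (x : {fraction A}) :
  x = tofrac \n_(repr x) / tofrac \d_(repr x).
Proof.
rewrite -[x in LHS]reprK; move: (repr x) => r.
have dN0 := denom_ratioP r.
apply: (@mulIf _ (tofrac \d_r)); first by rewrite tofrac_eq0.
rewrite divfK ?tofrac_eq0 //; unlock tofrac; rewrite -[LHS]FracField.pi_mul.
apply/eqmodP; rewrite /= FracField.equivfE /FracField.mulf /=.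
by rewrite !numden_Ratio ?mulf_neq0 ?oner_neq0 // !mulr1 mulrC.
Qed.

Lemma fracP (A : idomainType) (x : {fraction A}) :
  exists p q : A, q != 0 /\ x = tofrac p / tofrac q.
Proof.
by exists \n_(repr x), \d_(repr x); split; [exact: denom_ratioP|exact: frac_numdenE].
Qed.

Section FractionDerivation.
Variables (A : idomainType) (D : A -> A).
Hypothesis DD : forall x y, D (x + y) = D x + D y.
Hypothesis DM : forall x y, D (x * y) = D x * y + x * D y.

Definition frac_der_fun (x : {fraction A}) : {fraction A} :=
  let p := \n_(repr x) in let q := \d_(repr x) in
  tofrac (D p * q - p * D q) / tofrac q ^+ 2.

Lemma frac_der_fracE (p q : A) : q != 0 ->
  frac_der_fun (tofrac p / tofrac q) = tofrac (D p * q - p * D q) / tofrac q ^+ 2.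
Proof.
move=> q0; rewrite /frac_der_fun; set x := tofrac p / tofrac q.
have := frac_numdenE x; have := denom_ratioP (repr x).
set a := \n_(repr x); set b := \d_(repr x) => b0 /eqP.
rewrite /x eqr_div ?tofrac_eq0 // -!rmorphM /= tofrac_eq => /eqP e.
have e' := congr1 D e; rewrite !DM in e'.
apply/eqP; rewrite eqr_div ?expf_neq0 ?tofrac_eq0 // -!rmorphXn -!rmorphM /=.
rewrite tofrac_eq; apply/eqP.
move: e e'; move: (D a) (D b) (D p) (D q) => a' b' p' q' e e'.
have -> : (a' * b - a * b') * q ^+ 2 = b * q * (a' * q + a * q')
   - b * q' * (a * q) - b' * q * (a * q) by ring.
rewrite -e -e'; ring.
Qed.

Fact frac_derD x y : frac_der_fun (x + y) = frac_der_fun x + frac_der_fun y.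
Proof.
have [a [b [b0 ->]]] := fracP x; have [c [d [d0 ->]]] := fracP y.
have [b1 d1] : tofrac b != 0 /\ tofrac d != 0 by rewrite !tofrac_eq0.
rewrite (addf_div _ _ b1 d1) -!tofracM -tofracD.
rewrite (frac_der_fracE _ (mulf_neq0 b0 d0)).
rewrite (frac_der_fracE _ b0) (frac_der_fracE _ d0).
rewrite !DD !DM !(tofracB, tofracD, tofracM).
exact: quotient_ruleD b1 d1.
Qed.

Fact frac_derM x y :
  frac_der_fun (x * y) = frac_der_fun x * y + x * frac_der_fun y.
Proof.
have [a [b [b0 ->]]] := fracP x; have [c [d [d0 ->]]] := fracP y.
have [b1 d1] : tofrac b != 0 /\ tofrac d != 0 by rewrite !tofrac_eq0.
rewrite mulf_div -!tofracM (frac_der_fracE _ (mulf_neq0 b0 d0)).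
rewrite (frac_der_fracE _ b0) (frac_der_fracE _ d0).
rewrite !DM !(tofracB, tofracD, tofracM).
exact: quotient_ruleM b1 d1.
Qed.

Definition frac_der : derivation {fraction A} := Derivation frac_derD frac_derM.

Lemma frac_der_tofrac p : frac_der (tofrac p) = tofrac (D p).
Proof.
rewrite -[tofrac p]divr1 -tofrac1 /= frac_der_fracE ?oner_neq0 //.
have -> : D 1 = 0 by apply: der_one DM.
by rewrite mulr1 mulr0 subr0 tofrac1 expr1n divr1.
Qed.

End FractionDerivation.

Section FractionLift.
Variables (A : idomainType) (E : fieldType) (phi : {rmorphism A -> E}).
Hypothesis phi_inj : forall p, phi p = 0 -> p = 0.

Definition frac_lift (x : {fraction A}) : E :=
  phi \n_(repr x) / phi \d_(repr x).

Fact phi_neq0 p : p != 0 -> phi p != 0.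
Proof. by apply: contra => /eqP/phi_inj->. Qed.

Lemma frac_liftE p q : q != 0 -> frac_lift (tofrac p / tofrac q) = phi p / phi q.
Proof.
move=> q0; rewrite /frac_lift; set x := tofrac p / tofrac q.
have := frac_numdenE x; have := denom_ratioP (repr x).
set a := \n_(repr x); set b := \d_(repr x) => b0 /eqP.
rewrite /x eqr_div ?tofrac_eq0 // -!rmorphM /= tofrac_eq => /eqP e.
by apply/eqP; rewrite eqr_div ?phi_neq0 // -!rmorphM -e.
Qed.

Lemma frac_lift_tofrac p : frac_lift (tofrac p) = phi p.
Proof.
by rewrite -[tofrac p]divr1 -tofrac1 frac_liftE ?oner_neq0 // rmorph1 divr1.
Qed.

Fact frac_lift_zmod : zmod_morphism frac_lift.
Proof.
move=> x y; have [a [b [b0 ->]]] := fracP x; have [c [d [d0 ->]]] := fracP y.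
have [b1 d1] : tofrac b != 0 /\ tofrac d != 0 by rewrite !tofrac_eq0.
rewrite -mulNr (addf_div _ _ b1 d1) -!(tofracM, tofracN, tofracD).
rewrite !frac_liftE ?mulf_neq0 // !(rmorphD, rmorphM, rmorphN).
by rewrite -[- (_ / _)]mulNr addf_div ?phi_neq0 // mulNr.
Qed.

Fact frac_lift_monoid : monoid_morphism frac_lift.
Proof.
split; first by rewrite -tofrac1 frac_lift_tofrac rmorph1.
move=> x y; have [a [b [b0 ->]]] := fracP x; have [c [d [d0 ->]]] := fracP y.
by rewrite mulf_div -!tofracM !frac_liftE ?mulf_neq0 // !rmorphM mulf_div.
Qed.

HB.instance Definition _ := GRing.isZmodMorphism.Build {fraction A} E frac_lift
  frac_lift_zmod.
HB.instance Definition _ := GRing.isMonoidMorphism.Build {fraction A} E frac_lift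
  frac_lift_monoid.

End FractionLift.

End FractionField.

(** * Rational functions as Laurent series in t = 1/tau *)

Section ExpansionAtInfinity.
Variable C : fieldType.
Local Notation PS := (powser C).
Local Notation K := (ratfun C).

(* [laurent] is the field C((t)) of formal expansions at infinity, known only
   as a fraction field of the ring of power series. *)
Variables (laurent : fieldType) (of_ps : {rmorphism PS -> laurent}).
Hypothesis of_ps_eq0 : forall f, (of_ps f == 0) = (f == 0).
Variable l_theta : derivation laurent.
Hypothesis l_theta_ps : forall f, l_theta (of_ps f) = of_ps (ps_theta f).

Definition lpoly (p : {poly C}) : laurent := of_ps (ps_poly p).
HB.instance Definition _ := GRing.RMorphism.copy lpoly (of_ps \o @ps_poly C).

Definition r_theta : derivation K := scale_der (ratfun_der C) (ratfun_tau C).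

Lemma ps_poly_eq0 p : (ps_poly p == 0 :> PS) = (p == 0).
Proof.
apply/eqP/eqP=> [e|->]; last exact: rmorph0.
by apply/polyP=> i; rewrite -ps_polyE e ps_0E coef0.
Qed.

Lemma lpoly_eq0 p : (lpoly p == 0) = (p == 0).
Proof. by rewrite of_ps_eq0 ps_poly_eq0. Qed.

Definition lpolyC (c : C) : laurent := lpoly c%:P.
HB.instance Definition _ := GRing.RMorphism.copy lpolyC (lpoly \o @polyC C).

Definition eval_inv (p : {poly C}) : laurent := (map_poly lpolyC p).[(lpoly 'X)^-1].
HB.instance Definition _ := GRing.RMorphism.copy eval_inv
  (horner_eval (lpoly 'X)^-1 \o map_poly lpolyC).

Lemma eval_invX : eval_inv 'X = (lpoly 'X)^-1.
Proof. by rewrite /eval_inv map_polyX hornerX. Qed.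

Lemma eval_invC c : eval_inv c%:P = lpolyC c.
Proof. by rewrite /eval_inv map_polyC hornerC. Qed.

Lemma lpolyX_neq0 : lpoly 'X != 0.
Proof. by rewrite lpoly_eq0 polyX_eq0. Qed.

Lemma eval_invE p : exists q m, eval_inv p = lpoly q / lpoly 'X ^+ m.
Proof.
elim/poly_ind: p => [|p c [q [m IH]]].
  by exists 0, 0%N; rewrite !rmorph0 mul0r.
exists (q + c *: 'X^(m.+1)), m.+1.
rewrite !rmorphD !rmorphM /= eval_invX eval_invC IH -mul_polyC rmorphM /= rmorphXn /=.
by rewrite /lpolyC exprS; field; rewrite lpolyX_neq0 expf_neq0 // lpolyX_neq0.
Qed.

(** Multiplying p(1/t) by t to the degree of p reverses the coefficients, so the constant term
    becomes the leading coefficient of p. *)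
Lemma eval_inv_inj p : eval_inv p = 0 -> p = 0.
Proof.
move=> e; apply/eqP; case: (eqVneq p 0) => // p0.
have sz : size p = (size p).-1.+1 by rewrite prednK // size_poly_gt0.
have : lpoly (\sum_(i < size p) p`_i *: 'X^((size p).-1 - i)) = 0.
  rewrite -(mulr0 (lpoly 'X ^+ (size p).-1)) -e /eval_inv horner_poly.
  rewrite mulr_sumr rmorph_sum; apply: eq_bigr => i _ /=.
  have le : (i <= (size p).-1)%N by rewrite -ltnS -sz.
  rewrite -mul_polyC rmorphM rmorphXn /= -/(lpolyC _) mulrCA; congr (_ * _).
  by rewrite exprVn -{2}(subnK le) exprD mulfK // expf_neq0 // lpolyX_neq0.
move/eqP; rewrite lpoly_eq0 => /eqP /(congr1 (coefp 0)) /=.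
rewrite coef0 coef_sum sz big_ord_recr /= big1 => [|i _].
  by rewrite subnn expr0 coefZ coef1 mulr1 add0r => /eqP; rewrite -lead_coefE lead_coef_eq0 (negPf p0).
rewrite coefZ coefXn; have := ltn_ord i; rewrite -subn_gt0.
by case: (_ - _)%N => // k _; rewrite mulr0.
Qed.

Definition expand_fun : K -> laurent := frac_lift eval_inv.
HB.instance Definition _ := GRing.isZmodMorphism.Build K laurent expand_fun
  (frac_lift_zmod eval_inv_inj).
HB.instance Definition _ := GRing.isMonoidMorphism.Build K laurent expand_fun
  (frac_lift_monoid eval_inv_inj).
Definition expand : {rmorphism K -> laurent} := expand_fun.

Lemma expand_tau : expand (ratfun_tau C) = (lpoly 'X)^-1.
Proof. by rewrite /expand /= /expand_fun (frac_lift_tofrac eval_inv_inj) /= eval_invX. Qed.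

Lemma expand_cst c : expand (ratfun_cst c) = lpolyC c.
Proof. by rewrite /expand /= /expand_fun (frac_lift_tofrac eval_inv_inj) /= eval_invC. Qed.

Lemma expandP x : exists p q, q != 0 /\ expand x = lpoly p / lpoly q.
Proof.
have [a [b [b0 ->]]] := fracP x.
rewrite /expand /= /expand_fun (frac_liftE eval_inv_inj) //=.
have [p [m ->]] := eval_invE a; have [q [l e]] := eval_invE b.
have q0 : q != 0.
  apply: contra b0 => /eqP q0; apply/eqP/eval_inv_inj.
  by rewrite e q0 rmorph0 mul0r.
exists (p * 'X^l), (q * 'X^m); split.
  by rewrite mulf_neq0 // expf_neq0 // polyX_eq0.
rewrite e !rmorphM !rmorphXn /=; field.
by rewrite /= !expf_neq0 ?lpolyX_neq0 ?lpoly_eq0 ?q0.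
Qed.

Lemma l_theta_lpoly p : l_theta (lpoly p) = lpoly (- ('X * p^`())).
Proof. by rewrite l_theta_ps ps_theta_poly. Qed.

Lemma l_theta_eval_inv p : l_theta (eval_inv p) = eval_inv ('X * p^`()).
Proof.
have X0 := lpolyX_neq0.
elim/poly_ind: p => [|p c IH].
  by rewrite deriv0 mulr0 !rmorph0 (der0 l_theta).
rewrite rmorphD rmorphM /= eval_invX eval_invC (derD l_theta) (derM l_theta) IH.
have -> : l_theta (lpolyC c) = 0.
  by rewrite l_theta_lpoly derivC mulr0 oppr0 rmorph0.
have -> : l_theta (lpoly 'X)^-1 = (lpoly 'X)^-1.
  rewrite -[_^-1]mul1r (der_div l_theta) // (der1 l_theta) l_theta_lpoly derivX.
  by rewrite mulr1 rmorphN /=; field.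
rewrite derivD derivM derivX derivC addr0 mulr1 mulrDr !(rmorphD, rmorphM) /=.
by rewrite eval_invX; ring.
Qed.

Lemma expand_theta x : l_theta (expand x) = expand (r_theta x).
Proof.
have [a [b [b0 ->]]] := fracP x.
rewrite {1}/expand /= {1}/expand_fun (frac_liftE eval_inv_inj) //=.
have b1 : eval_inv b != 0 := phi_neq0 eval_inv_inj b0.
rewrite (der_div l_theta) // !l_theta_eval_inv /= ratfun_der_fracE //.
rewrite -[tofrac b ^+ 2]rmorphXn [expand (_ * _)]rmorphM /= expand_tau.
rewrite /expand /= /expand_fun (frac_liftE eval_inv_inj) ?expf_neq0 //=.
by rewrite !(rmorphM, rmorphB, rmorphXn) /= eval_invX; field; rewrite lpolyX_neq0 b1.
Qed.

End ExpansionAtInfinity.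

(** * The formal solutions *)

Section FormalSolution.
Variable C : numFieldType.
Local Notation PS := (powser C).
Variables (laurent : fieldType) (of_ps : {rmorphism PS -> laurent}).
Hypothesis of_ps_eq0 : forall f, (of_ps f == 0) = (f == 0).
Hypothesis laurentP : forall x, exists p q, q != 0 /\ x = of_ps p / of_ps q.
Variable l_theta : derivation laurent.
Hypothesis l_theta_ps : forall f, l_theta (of_ps f) = of_ps (ps_theta f).
Local Notation lpoly := (lpoly of_ps).
Local Notation lpolyC := (lpolyC of_ps).
Local Notation T := (lpoly ('X : {poly C})).

Lemma lnat_neq0 n : (n.+1%:R : laurent) != 0.
Proof.
have -> : n.+1%:R = lpolyC (n.+1%:R : C) by rewrite rmorph_nat.
by rewrite (lpoly_eq0 of_ps_eq0) polyC_eq0 pnatr_eq0.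
Qed.

(** No pole at t = 0. The quotient form admits denominators such as a + 1 without inverting them
    among power series. *)
Definition regular (x : laurent) :=
  exists f g : PS, g 0%N != 0 /\ x = of_ps f / of_ps g.

Lemma ps_unit0 (g : PS) : g 0%N != 0 -> of_ps g != 0.
Proof. by rewrite of_ps_eq0; apply: contra => /eqP ->; rewrite ps_0E. Qed.

Lemma regularD x y : regular x -> regular y -> regular (x + y).
Proof.
move=> [f [g [g0 ->]]] [f' [g' [g'0 ->]]].
exists (f * g' + f' * g), (g * g'); split; first by rewrite ps_mul0E mulf_neq0.
by rewrite addf_div ?ps_unit0 // rmorphD !rmorphM.
Qed.

Lemma regularN x : regular x -> regular (- x).
Proof.
by move=> [f [g [g0 ->]]]; exists (- f), g; rewrite rmorphN mulNr.
Qed.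

Lemma regular_ps f : regular (of_ps f).
Proof. by exists f, 1; rewrite rmorph1 divr1 ps_1E coef1 oner_neq0. Qed.

(** theta does not lower the order in t, so the logarithmic derivative of a nonzero c has no pole,
    whereas k t^-6 + e has a pole of order 6. *)
Lemma no_exponential k e c : k != 0 -> regular e ->
  l_theta c = (lpolyC k * T ^- 6 + e) * c -> c = 0.
Proof.
move=> k0 [f [g [g0 ->]]]; have [p [q [q0 ->]]] := laurentP c.
move=> E; case: (eqVneq p 0) => [->|p0].
  by rewrite rmorph0 mul0r.
have T0 := lpolyX_neq0 of_ps_eq0.
have [m [p1 [pE p10]]] := ps_order p0; have [l [q1 [qE q10]]] := ps_order q0.
have X m' : l_theta (T ^+ m') = - (m'%:R * T ^+ m').
  rewrite (derXn l_theta) (l_theta_lpoly l_theta_ps) derivX mulr1 rmorphN mulrN.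
  by case: m' => [|m']; rewrite ?mul0r // -mulrA -exprSr.
have [q10' g0'] := (ps_unit0 q10, ps_unit0 g0).
move: E; rewrite pE qE !rmorphM !rmorphXn /= -![of_ps (ps_poly 'X)]/T.
rewrite (der_div (l_theta)) ?mulf_neq0 ?expf_neq0 // !(derM (l_theta)) !X.
rewrite !l_theta_ps => E.
(* With denominators cleared, the left side is divisible by t^6 while the constant term on the right
   is a product of nonzero factors. *)
have : of_ps (ps_poly 'X^6 * g * (ps_theta p1 * q1 - p1 * ps_theta q1
    + (l%:R - m%:R) * p1 * q1)) =
    of_ps ((ps_poly k%:P * g + ps_poly 'X^6 * f) * p1 * q1).
  rewrite !(rmorphM, rmorphD, rmorphB, rmorph_nat, rmorphXn) /=.
  rewrite -![of_ps (ps_poly 'X)]/T -/(lpoly _) -/(lpolyC _).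
  set P := of_ps p1 in E *; set Q := of_ps q1 in E *; set G := of_ps g in E g0' *.
  set F := of_ps f in E *; set P' := of_ps _ in E *; set Q' := of_ps _ in E *.
  move: E => /(congr1 (fun x => x * (T ^+ 6 * G * Q ^+ 2 * T ^+ l / T ^+ m))).
  rewrite -/Q in q10'.
  have [Tl Tm] : T ^+ l != 0 /\ T ^+ m != 0 by rewrite !expf_neq0.
  move: Tl Tm; move: (T ^+ l) (T ^+ m) => Tl Tm Tl0 Tm0 E.
  apply: etrans (etrans E _); field; rewrite ?T0 ?Tl0 ?Tm0 ?q10' ?g0' //.
move/eqP; rewrite -subr_eq0 -rmorphB of_ps_eq0 subr_eq0 => /eqP /(congr1 (@^~ 0%N)) /=.
rewrite !(ps_mul0E, ps_addE) !ps_polyE !coefXn coefC /= !mul0r addr0.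
by move/esym/eqP; rewrite !mulf_eq0 (negPf k0) (negPf g0) (negPf p10) (negPf q10).
Qed.

Variable lam : C.
Hypothesis lam0 : lam != 0.

(** Since (2k+1)(36k^2-1) = 72 (k+1/2)(k-1/6)(k+1/6), these are the coefficients of 3F0(1/2, -1/6,
    1/6) in the variable 36 t^12 / lam^2, up to the substitution carrying [k] to the exponent 12
    k. *)
Fixpoint acoef k : C :=
  if k is k'.+1 then
    acoef k' * ((2 * k'%:R + 1) * (36 * k'%:R ^+ 2 - 1)) / (2 * lam ^+ 2 * k'.+1%:R)
  else 1.

Definition aser : PS := fun n => if (12 %| n)%N then acoef (n %/ 12)%N else 0.

(** Coefficient form of the equation left for a when b and c are eliminated from theta a = b - c,
    theta b = 2a - 2lb, theta c = 2lc - 2a with l = lam t^-6; theta is multiplication by -m on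
    t^m. *)
Lemma aser_rec m :
  4 * lam ^+ 2 * (m + 12)%:R * aser (m + 12)%N =
  (m%:R + 6) * (m%:R ^+ 2 - 4) * aser m.
Proof.
rewrite /aser dvdn_addl //; case: ifP => [/dvdnP[k ->]|]; last by rewrite !mulr0.
have -> : (k * 12 + 12 = k.+1 * 12)%N by rewrite mulSn addnC.
rewrite !mulnK // /= !natrM -natr1; field.
by rewrite lam0 addrC natr1 pnatr_eq0.
Qed.

Definition av : laurent := of_ps aser.
Definition lv : laurent := lpolyC lam * T ^- 6.
(** q = b - c is theta a, and p = b + c is then solved from theta q = 4a - 2lp. Division by 2l
    produces the factor t^6. *)
Definition qser : PS := ps_theta aser.
Definition pser : PS :=
  ps_poly ((2 * lam)^-1 *: 'X^6) * (4 * aser - ps_theta (ps_theta aser)).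
Definition qv : laurent := of_ps qser.
Definition pv : laurent := of_ps pser.
Definition bv : laurent := (pv + qv) / 2.
Definition cv : laurent := (pv - qv) / 2.

Lemma lvp : 2 * lv * pv = 4 * av - l_theta qv.
Proof.
have T0 := lpolyX_neq0 of_ps_eq0.
have l0 : lpolyC lam != 0 by rewrite (lpoly_eq0 of_ps_eq0) polyC_eq0.
rewrite /lv /pv /pser rmorphM /= -mul_polyC rmorphM /= rmorphXn /= -[ps_poly _%:P]/_.
rewrite rmorphM rmorphXn /= -/(lpoly _) -/(lpolyC _) -/(lpoly 'X).
rewrite fmorphV rmorphM rmorph_nat rmorphB rmorphM rmorph_nat /=.
rewrite /qv l_theta_ps -/av /qser; set x := of_ps (ps_theta _); field.
by rewrite T0 l0 -(@natr1 _ 1) -[1 + 1]/(2%:R) lnat_neq0.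
Qed.

Lemma l_theta_av : l_theta av = qv.
Proof. exact: l_theta_ps. Qed.

(** The only one of the three first-order equations that is not a definition in disguise: compared
    coefficientwise, it is [aser_rec]. *)
Lemma l_theta_pv : l_theta pv = - (2 * lv * qv).
Proof.
have T0 := lpolyX_neq0 of_ps_eq0.
suff e : ps_poly 'X^6 * ps_theta pser = ps_poly (- (2 * lam))%:P * qser.
  apply: (mulfI (expf_neq0 6 T0)); rewrite l_theta_ps /lv /qv.
  have E6 : of_ps (ps_poly 'X^6) = T ^+ 6 by rewrite !rmorphXn.
  have El : of_ps (ps_poly (- (2 * lam))%:P) = - (2 * lpolyC lam).
    by rewrite -[LHS]/(lpolyC _) rmorphN rmorphM rmorph_nat.
  have := congr1 of_ps e; rewrite rmorphM E6 => ->.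
  by rewrite rmorphM El; field.
have l0 := lam0; apply/funext=> n; rewrite ps_XnmulE ps_CmulE.
(* Below degree 12 both sides vanish: there a has only its constant term, which theta kills, and p
   has order at least 6. *)
have [lt|le] := ltnP n 12.
  have -> : qser n = 0.
    rewrite /qser /ps_theta /aser; case: ifP; rewrite ?mulr0 ?oppr0 //.
    case: n lt => [|n] lt; first by rewrite mul0r oppr0.
    by move/(dvdn_leq (ltn0Sn n)); rewrite leqNgt lt.
  rewrite mulr0; case: ltnP => // le.
  rewrite /ps_theta /pser -mul_polyC rmorphM /= -mulrA ps_CmulE ps_XnmulE.
  have -> : (n - 6 < 6)%N by rewrite ltn_subLR.
  by rewrite !mulr0 oppr0.
rewrite -(subnK le); set m := (n - 12)%N.
have -> : (m + 12 < 6)%N = false by rewrite ltnNge (leq_trans _ (leq_addl m 12)).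
have -> : (m + 12 - 6 = m + 6)%N by rewrite -addnBA.
rewrite /qser /ps_theta /pser -mul_polyC rmorphM /= -mulrA ps_CmulE ps_XnmulE.
rewrite ltnNge leq_addl /= addnK ps_addE ps_oppE.
have -> : (4 * aser) m = 4 * aser m.
  have -> : (4 : PS) = ps_poly 4%:P by rewrite !rmorph_nat.
  exact: ps_CmulE.
have := aser_rec m; rewrite !natrD /= => e.
apply: (mulIf l0); apply: (mulIf (_ : 2 != 0 :> C)); first by rewrite pnatr_eq0.
transitivity (4 * lam ^+ 2 * (m%:R + 12) * aser (m + 12)%N); last by ring.
by rewrite e /ps_theta; field.
Qed.

Lemma l_theta_qv : l_theta qv = 4 * av - 2 * lv * pv.
Proof. by rewrite lvp opprB addrC subrK. Qed.

Let two0 : (2 : laurent) != 0. Proof. exact: lnat_neq0. Qed.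
Let four0 : (4 : laurent) != 0. Proof. exact: lnat_neq0. Qed.

Lemma l_theta_two : l_theta 2 = 0.
Proof. by rewrite -[2]/(1 + 1) derD (der1 l_theta) addr0. Qed.

Lemma l_theta_bv : l_theta bv = 2 * av - 2 * lv * bv.
Proof.
rewrite /bv (der_div l_theta) // derD l_theta_pv l_theta_qv l_theta_two.
by field; rewrite ?two0 ?four0.
Qed.

Lemma l_theta_cv : l_theta cv = 2 * lv * cv - 2 * av.
Proof.
rewrite /cv (der_div l_theta) // (derB l_theta) l_theta_pv l_theta_qv l_theta_two.
by field; rewrite ?two0 ?four0.
Qed.

Lemma av_bv_cv : l_theta av = bv - cv.
Proof. by rewrite l_theta_av /bv /cv; field; rewrite ?two0 ?four0. Qed.

Lemma ps_theta_eq0 (f : PS) : ps_theta f = 0 -> f = ps_poly (f 0%N)%:P.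
Proof.
move=> e; apply/funext=> n; rewrite ps_polyE coefC.
case: n => [//|n] /=; have := congr1 (fun g : PS => g n.+1) e; move/eqP.
by rewrite ps_0E /ps_theta oppr_eq0 mulf_eq0 pnatr_eq0 => /eqP.
Qed.

(** The left side is -det S, which is constant because theta S is a commutator with S. In terms of p
    and q, four times it is 4a^2 + p^2 - q^2; its value at t = 0 is found from a = 1, p = q = 0. *)
Lemma first_integral : av ^+ 2 + bv * cv = 1.
Proof.
pose f : PS := 4 * aser * aser + pser * pser - qser * qser.
have fE : of_ps f = 4 * av * av + pv * pv - qv * qv.
  rewrite /f /av /pv /qv; move: pser qser => P Q.
  by rewrite rmorphB rmorphD !rmorphM rmorph_nat.
have p0 : pser 0%N = 0.
  by rewrite /pser -mul_polyC rmorphM /= -mulrA ps_CmulE ps_XnmulE mulr0.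
have q0 : qser 0%N = 0 by rewrite /qser /ps_theta mul0r oppr0.
have f0 : f 0%N = 4.
  rewrite /f; move: p0 q0; move: pser qser => P Q p0 q0.
  rewrite ps_addE ps_oppE ps_addE !ps_mul0E p0 q0 ps_natE coefC /=.
  by rewrite /aser /= !mulr0 oppr0 !addr0 !mulr1.
have : ps_theta f = 0.
  apply/eqP; rewrite -of_ps_eq0 -l_theta_ps fE (derB l_theta) derD !(derM l_theta).
  rewrite l_theta_av l_theta_pv l_theta_qv.
  have -> : l_theta 4 = 0.
    have -> : (4 : laurent) = 2 * 2 by ring.
    by rewrite derM l_theta_two mulr0 mul0r addr0.
  by apply/eqP; ring.
move/ps_theta_eq0/(congr1 of_ps); rewrite fE f0 !rmorph_nat => e.
apply: (mulfI four0); rewrite mulr1 -[RHS]e /bv /cv.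
by field; rewrite ?two0 ?four0.
Qed.

Lemma regular_sum1 : regular (bv / (av + 1)) /\ regular (cv / (av + 1)).
Proof.
have a1 : av + 1 = of_ps (aser + 1) by rewrite rmorphD rmorph1.
have a10 : (aser + 1) 0%N != 0.
  by rewrite ps_addE ps_1E coef1 /aser /= -[1 + 1]/(2%:R : C) pnatr_eq0.
have two : ps_poly 2%:P * (aser + 1) = 2 * (aser + 1).
  by rewrite !rmorph_nat.
have u : ((2 : PS) * (aser + 1)) 0%N != 0.
  by rewrite -two ps_CmulE mulf_neq0 // pnatr_eq0.
have a1' := ps_unit0 a10; split.
  exists (pser + qser), (2 * (aser + 1)); split=> //.
  rewrite a1 rmorphM rmorph_nat; move: (of_ps (aser + 1)) a1' => A A0.
  by rewrite rmorphD /bv; field; rewrite two0 A0.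
exists (pser - qser), (2 * (aser + 1)); split=> //.
rewrite a1 rmorphM rmorph_nat; move: (of_ps (aser + 1)) a1' => A A0.
by rewrite rmorphB /cv; field; rewrite two0 A0.
Qed.

Lemma av1_neq0 : av + 1 != 0.
Proof.
have -> : av + 1 = of_ps (aser + 1) by rewrite rmorphD rmorph1.
by apply: ps_unit0; rewrite ps_addE ps_1E coef1 /aser /= -[1 + 1]/(2%:R : C) pnatr_eq0.
Qed.
End FormalSolution.

(** * Independence over C(tau) of the hypergeometric series and its derivatives *)

Section HypergeometricIndependence.
Variable C : numFieldType.

Lemma poly_nat_eq0 (p : {poly C}) : (forall n, p.[n%:R] = 0) -> p = 0.
Proof.
move=> h; apply/eqP/contraT => p0.
have := max_poly_roots p0 (rs := [seq i%:R | i <- iota 0 (size p)]).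
rewrite size_map size_iota ltnn => -> //.
  by apply/allP=> _ /mapP[i _ ->]; rewrite /root h.
rewrite map_inj_in_uniq ?iota_uniq // => i k _ _ /eqP.
by rewrite eqr_nat => /eqP.
Qed.

Variable lam : C.
Hypothesis lam0 : lam != 0.
Local Notation A := (acoef lam).

(* The numerator of [A k.+1 / A k]; its denominator is [k + 1]. *)
Definition ratio_num : {poly C} :=
  (2 * lam ^+ 2)^-1 *: ((2 *: 'X + 1%:P) * (36 *: 'X^2 - 1%:P)).

Lemma ratio_numE x :
  ratio_num.[x] = (2 * x + 1) * (36 * x ^+ 2 - 1) / (2 * lam ^+ 2).
Proof.
by rewrite hornerZ hornerM hornerD hornerD hornerN !hornerZ hornerX hornerXn !hornerC mulrC.
Qed.

Lemma acoefS k : A k.+1 * (k%:R + 1) = ratio_num.[k%:R] * A k.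
Proof.
have k1 : (k%:R + 1 : C) != 0 by rewrite natr1 pnatr_eq0.
by rewrite ratio_numE /= -natr1; field; rewrite lam0 addrC k1.
Qed.

Lemma acoef_neq0 k : A k != 0.
Proof.
elim: k => [|k IH]; first exact: oner_neq0.
have k1 : (k%:R + 1 : C) != 0 by rewrite natr1 pnatr_eq0.
apply: contraNneq (_ : ratio_num.[k%:R] * A k != 0) => [e|].
  by rewrite -acoefS e mul0r.
rewrite mulf_neq0 // ratio_numE !mulf_neq0 ?invr_neq0 ?mulf_neq0 ?expf_neq0 //.
- by rewrite -natrM natr1 pnatr_eq0.
- by rewrite subr_eq0 -natrX -natrM pnatr_eq1; lia.
- by rewrite pnatr_eq0.
Qed.

(** The product (X + 1)...(X + J), a common denominator for the ratios of [A (k + i)] to [A k] with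
    i at most J. *)
Fixpoint shift_den J : {poly C} :=
  if J is J'.+1 then ('X + 1%:P) * (shift_den J' \Po ('X + 1%:P)) else 1.

Fixpoint shift_num (u : nat -> {poly C}) J : {poly C} :=
  if J is J'.+1 then ratio_num * (shift_num u J' \Po ('X + 1%:P)) + u J * shift_den J
  else u 0%N.

Lemma horner_shift (p : {poly C}) x : (p \Po ('X + 1%:P)).[x] = p.[x + 1].
Proof. by rewrite horner_comp hornerD hornerX hornerC. Qed.

Lemma shift_numE (u : nat -> {poly C}) J k :
  (shift_den J).[k%:R] * \sum_(j < J.+1) (u j).[(k + J - j)%:R] * A (k + J - j)%N
  = (shift_num u J).[k%:R] * A k.
Proof.
elim: J k => [|J IH] k /=.
  by rewrite -[1]/(1%:P) hornerC big_ord1 addn0 subn0 mul1r.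
rewrite big_ord_recr /= addnK mulrDr hornerD !hornerM !horner_shift hornerD.
rewrite hornerX hornerC [RHS]mulrDl; congr (_ + _); last by ring.
have e1 : (k%:R + 1 : C) = k.+1%:R by rewrite natr1.
rewrite e1 -mulrA [X in k.+1%:R * X](_ : _ = (shift_num u J).[k.+1%:R] * A k.+1).
  by rewrite mulrCA [_ * A _]mulrC -e1 acoefS mulrCA mulrA.
rewrite -IH; congr (_ * _); apply: eq_bigr => j _.
by rewrite addSnnS.
Qed.

Lemma shift_den_neq0 J x : (forall m, x + m.+1%:R != 0) -> (shift_den J).[x] != 0.
Proof.
elim: J x => [|J IH] x h /=; first by rewrite -[1]/(1%:P) hornerC oner_eq0.
rewrite hornerM horner_shift hornerD hornerX hornerC mulf_neq0 //; first exact: (h 0%N).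
by apply: IH => m; rewrite -addrA nat1r.
Qed.

(* The roots -1/2, 1/6, -1/6 of [ratio_num] are not integers, so at these points
   only the term of highest index survives. *)
Lemma shift_num_eq0 (u : nat -> {poly C}) J : (forall j, (size (u j) <= 3)%N) ->
  shift_num u J = 0 -> forall j, (j <= J)%N -> u j = 0.
Proof.
move=> su; elim: J => [|J IH] /= e j; first by rewrite leqn0 => /eqP->.
have uJ : u J.+1 = 0.
  apply/eqP/contraT => u0.
  have := max_poly_roots u0 (rs := [:: - 2^-1; 6^-1; - 6^-1]).
  have rt z : ratio_num.[z] = 0 -> (forall m, z + m.+1%:R != 0) -> root (u J.+1) z.
    move=> rz hz; have := congr1 (horner^~ z) e; rewrite horner0 hornerD !hornerM rz.
    rewrite mul0r add0r => /eqP; rewrite mulf_eq0 => /orP[//|].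
    by have := shift_den_neq0 J.+1 hz; rewrite /= hornerM => /negPf->.
  have n0 n : (n.+1%:R : C) != 0 by rewrite pnatr_eq0.
  have E2 m : - 2^-1 + m.+1%:R = (m.*2.+1)%:R / 2 :> C.
    by rewrite -natr1 -[m.*2.+1]addn1 -muln2 natrD natrM; field; rewrite ?n0.
  have E6 m : 6^-1 + m.+1%:R = (6 * m.+1 + 1)%:R / 6 :> C.
    by rewrite natrD natrM; field; rewrite ?n0.
  have E6' m : - 6^-1 + m.+1%:R = (6 * m + 5)%:R / 6 :> C.
    by rewrite -natr1 natrD natrM; field; rewrite ?n0.
  have r1 : root (u J.+1) (- 2^-1).
    apply: rt => [|m]; last by rewrite E2 mulf_neq0 ?invr_neq0 ?n0.
    by rewrite ratio_numE; field; rewrite lam0 ?n0.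
  have r2 : root (u J.+1) 6^-1.
    apply: rt => [|m]; last by rewrite E6 mulf_neq0 ?invr_neq0 ?n0 // addn1 n0.
    by rewrite ratio_numE; field; rewrite lam0 ?n0.
  have r3 : root (u J.+1) (- 6^-1).
    apply: rt => [|m]; last by rewrite E6' mulf_neq0 ?invr_neq0 ?n0 // addnS n0.
    by rewrite ratio_numE; field; rewrite lam0 ?n0.
  rewrite /= r1 r2 r3.
  move=> /(_ isT); rewrite ltnNge su /=; apply.
  rewrite !inE andbT negb_or; apply/andP; split; [apply/andP; split|].
  - rewrite -subr_eq0 (_ : _ - _ = - (4%:R / 6%:R)); last by field; rewrite ?n0.
    by rewrite oppr_eq0 mulf_neq0 ?invr_neq0 ?n0.
  - rewrite -subr_eq0 (_ : _ - _ = - (2%:R / 6%:R)); last by field; rewrite ?n0.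
    by rewrite oppr_eq0 mulf_neq0 ?invr_neq0 ?n0.
  - rewrite -subr_eq0 (_ : _ - _ = 2%:R / 6%:R); last by field; rewrite ?n0.
    by rewrite mulf_neq0 ?invr_neq0 ?n0.
rewrite leq_eqVlt ltnS => /orP[/eqP->//|]; apply: IH => {j}.
move/eqP: e; rewrite uJ mul0r addr0 mulf_eq0 => /orP[/eqP r0|/eqP Z0].
  have := ratio_numE 0; rewrite r0 horner0 mulr0 expr0n /= mulr0 add0r sub0r mul1r.
  move/esym/eqP; rewrite mulf_eq0 oppr_eq0 oner_eq0 invr_eq0 mulf_eq0 pnatr_eq0.
  by rewrite expf_eq0 (negPf lam0) andbF.
by apply/eqP; rewrite -(comp_poly2_eq0 _ (size_XaddC 1)) Z0.
Qed.

Lemma sum_residue (m r k : nat) (G : nat -> C) : (r < m)%N ->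
  (forall i, (i <= m * k + r)%N -> (i %% m)%N != r -> G i = 0) ->
  \sum_(i < (m * k + r).+1) G i = \sum_(j < k.+1) G (m * j + r)%N.
Proof.
move=> rm; elim: k => [|k IH] G0.
  rewrite muln0 add0n big_ord1 big_ord_recr /= big1 ?add0r //.
    by rewrite muln0.
  move=> i _; have ir := ltn_ord i; apply: G0; first by rewrite muln0 ltnW.
  by rewrite modn_small ?neq_ltn ?ir // (ltn_trans _ rm).
have -> : (m * k.+1 + r).+1 = ((m * k + r).+1 + m)%N by lia.
rewrite big_split_ord /= IH => [|i le]; last by apply: G0; lia.
rewrite [RHS]big_ord_recr /=; congr (_ + _).
case: m rm G0 {IH} => // m rm G0.
rewrite big_ord_recr /= big1 ?add0r => [|i _]; first by congr G; lia.
have im := ltn_ord i; apply: G0; first by lia.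
have -> : ((m.+1 * k + r).+1 + i = k * m.+1 + (r + i.+1))%N by lia.
rewrite modnMDl.
have [lt|le] := ltnP (r + i.+1)%N m.+1; first by rewrite modn_small //; lia.
by rewrite -(subnK le) modnDr modn_small; lia.
Qed.

(** Only exponents divisible by 12 occur in the series, so the relation splits by residues modulo
    12. On the term of exponent 12 k, theta is -12 k; this makes [w i] a quadratic polynomial in k
    and leaves one relation between shifted values of [A] per residue. *)
Lemma theta_free_poly (P Q R : {poly C}) :
  ps_poly P * aser lam + ps_poly Q * ps_theta (aser lam)
    + ps_poly R * ps_theta (ps_theta (aser lam)) = 0 ->
  [/\ P = 0, Q = 0 & R = 0].
Proof.
move=> e.
pose w i : {poly C} := (P`_i)%:P - (12 * Q`_i) *: 'X + (144 * R`_i) *: 'X^2.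
have sw i : (size (w i) <= 3)%N.
  rewrite (leq_trans (size_polyD _ _)) // geq_max (leq_trans (size_polyD _ _)) /=.
    by rewrite (leq_trans (size_scale_leq _ _)) // size_polyXn.
  rewrite geq_max size_polyN (leq_trans (size_polyC_leq1 _)) //.
  by rewrite (leq_trans (size_scale_leq _ _)) // size_polyX.
have wE i k : (w i).[k%:R] = P`_i - (12 * k)%:R * Q`_i + (12 * k)%:R ^+ 2 * R`_i.
  by rewrite /w !hornerD hornerN !hornerZ hornerX hornerXn hornerC natrM; ring.
have coefE r k : (r < 12)%N ->
    \sum_(j < k.+1) (w (12 * j + r)%N).[(k - j)%:R] * A (k - j) = 0.
  move=> r12; have := congr1 (fun f : powser C => f (12 * k + r)%N) e.
  rewrite ps_0E !ps_addE !ps_mulE -!big_split /=; apply: etrans.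
  pose G i := (P`_i - (12 * k + r - i)%:R * Q`_i + (12 * k + r - i)%:R ^+ 2 * R`_i)
              * aser lam (12 * k + r - i)%N.
  transitivity (\sum_(i < (12 * k + r).+1) G i); last first.
    by apply: eq_bigr => i _; rewrite /G !ps_polyE /ps_theta; ring.
  rewrite sum_residue //.
    apply: eq_bigr => j _; rewrite /G wE.
    have -> : (12 * k + r - (12 * j + r) = 12 * (k - j))%N by lia.
    by rewrite /aser dvdn_mulr // mulKn.
  move=> i le ir; rewrite /G /aser; case: ifP; rewrite ?mulr0 // => /dvdnP[q qE].
  by case/eqP: ir; lia.
have w0 i : w i = 0.
  pose u j := w (12 * j + i %% 12)%N.
  have su j : (size (u j) <= 3)%N by exact: sw.
  (* The sizes make [u] vanish beyond [J]; the summand i ensures that the index [i %/ 12] is at most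
     [J]. *)
  pose J := (i + (size P + size Q + size R))%N.
  have wJ j : (J < j)%N -> u j = 0.
    move=> lt; have le : (J <= 12 * j + i %% 12)%N by lia.
    rewrite /u /w !nth_default; last 3 first.
    - by rewrite (leq_trans _ le) // (leq_trans _ (leq_addl _ _)) // leq_addl.
    - by rewrite (leq_trans _ le) // (leq_trans _ (leq_addl _ _)) // addnAC leq_addl.
    - by rewrite (leq_trans _ le) // (leq_trans _ (leq_addl _ _)) // -addnA leq_addr.
    by rewrite !mulr0 !scale0r polyC0 subr0 addr0.
  have -> : w i = u (i %/ 12)%N by rewrite /u mulnC -divn_eq.
  apply: (shift_num_eq0 (J := J) su); last by rewrite (leq_trans (leq_div _ _)) ?leq_addr.
  apply: poly_nat_eq0 => n; apply: (mulIf (acoef_neq0 n)); rewrite mul0r -shift_numE.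
  apply/eqP; rewrite mulf_eq0; apply/orP; right; apply/eqP.
  (* Taking the coefficient at n + J, not n, makes every index j up to [J] occur in the sum; the
     terms beyond [J] are zero. *)
  have := coefE (i %% 12)%N (n + J)%N (ltn_pmod i (ltn0Sn 11)).
  have -> : (n + J).+1 = (J.+1 + n)%N by lia.
  rewrite big_split_ord /= [X in _ + X]big1 ?addr0 // => j _.
  rewrite -/(u _) wJ; first by rewrite horner0 mul0r.
  by rewrite addSn ltnS leq_addr.
have PQR i : [/\ P`_i = 0, Q`_i = 0 & R`_i = 0].
  have := congr1 (fun p : {poly C} => (p`_0, p`_1, p`_2)) (w0 i).
  rewrite /w !(coefD, coefB, coefN, coefZ, coefC, coefX, coefXn) /=.
  rewrite !(mulr0, mulr1, addr0, add0r, subr0, sub0r, oppr0) => -[-> /eqP + /eqP].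
  by rewrite oppr_eq0 !mulf_eq0 !pnatr_eq0 /= => /eqP -> /eqP ->.
by split; apply/polyP=> i; rewrite coef0; case: (PQR i).
Qed.

End HypergeometricIndependence.

(** * Gauge transformation of the two blocks *)

Section SmallMatrices.
Variable R : comNzRingType.

Definition mx2 (a b c d : R) : 'M[R]_(1 + 1) := block_mx a%:M b%:M c%:M d%:M.

Lemma mx2M a b c d a' b' c' d' :
  mx2 a b c d *m mx2 a' b' c' d' =
  mx2 (a * a' + b * c') (a * b' + b * d') (c * a' + d * c') (c * b' + d * d').
Proof. by rewrite /mx2 mulmx_block -!scalar_mxM -!raddfD. Qed.

Lemma mx2D a b c d a' b' c' d' :
  mx2 a b c d + mx2 a' b' c' d' = mx2 (a + a') (b + b') (c + c') (d + d').
Proof. by rewrite /mx2 add_block_mx -!raddfD. Qed.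

Lemma mx2Z k a b c d : k *: mx2 a b c d = mx2 (k * a) (k * b) (k * c) (k * d).
Proof. by rewrite /mx2 scale_block_mx !scale_scalar_mx. Qed.

Lemma mx2_1 : mx2 1 0 0 1 = 1%:M.
Proof. by rewrite /mx2 raddf0 scalar_mx_block. Qed.

Lemma mx2_0 : mx2 0 0 0 0 = 0.
Proof. by rewrite /mx2 raddf0 block_mx0. Qed.

(* The corner [x] carries the polynomials that are not homogeneous in the
   entries of the two blocks. *)
Definition emx (x : R) (X Y : 'M[R]_(1 + 1)) : 'M[R]_(1 + (1 + 1 + (1 + 1))) :=
  block_mx x%:M 0 0 (block_mx X 0 0 Y).

Lemma emxM x X Y x' X' Y' :
  emx x X Y *m emx x' X' Y' = emx (x * x') (X *m X') (Y *m Y').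
Proof.
by rewrite /emx !mulmx_block !(mulmx0, mul0mx) !addr0 !add0r -scalar_mxM.
Qed.

Lemma emxD x X Y x' X' Y' :
  emx x X Y + emx x' X' Y' = emx (x + x') (X + X') (Y + Y').
Proof. by rewrite /emx !add_block_mx !addr0 -raddfD. Qed.

Lemma emxZ k x X Y : k *: emx x X Y = emx (k * x) (k *: X) (k *: Y).
Proof. by rewrite /emx !scale_block_mx !scaler0 scale_scalar_mx. Qed.

Lemma emxN x X Y : - emx x X Y = emx (- x) (- X) (- Y).
Proof. by rewrite -scaleN1r emxZ mulN1r !scaleN1r. Qed.

Lemma emx1 : emx 1 1%:M 1%:M = 1%:M.
Proof. by rewrite /emx -!scalar_mx_block. Qed.

Lemma emx0 : emx 0 0 0 = 0.
Proof. by rewrite /emx raddf0 !block_mx0. Qed.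

Lemma emx_sum1 X Y Z :
  emx 0 X 0 + (emx 0 Y 0 + emx 0 Z 0) = emx 0 (X + (Y + Z)) 0.
Proof. by rewrite [emx 0 Y 0 + _]emxD emxD !addr0. Qed.

Lemma emx_sum2 X Y Z :
  emx 0 0 X + (emx 0 0 Y + emx 0 0 Z) = emx 0 0 (X + (Y + Z)).
Proof. by rewrite [emx 0 0 Y + _]emxD emxD !addr0. Qed.

Definition erow (x a b c d : R) : 'rV[R]_(1 + (1 + 1 + (1 + 1))) :=
  row_mx x%:M (row_mx (row_mx a%:M b%:M) (row_mx c%:M d%:M)).

Lemma diag_erow x a b c d :
  diag_mx (erow x a b c d) = emx x (mx2 a 0 0 b) (mx2 c 0 0 d).
Proof.
have d1 y : diag_mx (y%:M : 'M[R]_1) = y%:M.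
  by apply/matrixP=> i j; rewrite !mxE !ord1.
by rewrite /erow !diag_mx_row !d1 /emx /mx2 raddf0.
Qed.

Lemma erowD x a b c d x' a' b' c' d' :
  erow x a b c d + erow x' a' b' c' d' =
  erow (x + x') (a + a') (b + b') (c + c') (d + d').
Proof. by rewrite /erow !add_row_mx -!raddfD. Qed.

Lemma erowZ k x a b c d :
  k *: erow x a b c d = erow (k * x) (k * a) (k * b) (k * c) (k * d).
Proof. by rewrite /erow !scale_row_mx !scale_scalar_mx. Qed.

Lemma erowP (P : R -> Prop) x a b c d :
  P x -> P a -> P b -> P c -> P d -> forall i, P (erow x a b c d 0 i).
Proof.
move=> Px Pa Pb Pc Pd i; rewrite /erow !mxE.
have s y k : (y%:M : 'M[R]_1) 0 k = y by rewrite mxE ord1 mulr1n.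
case: split => i1; rewrite ?s // mxE.
by case: split => i2; rewrite mxE; case: split => i3; rewrite s.
Qed.

End SmallMatrices.

Lemma map_mx2 (R S : comNzRingType) (f : R -> S) a b c d : f 0 = 0 ->
  map_mx f (mx2 a b c d) = mx2 (f a) (f b) (f c) (f d).
Proof.
move=> f0; have s y : map_mx f (y%:M : 'M_1) = (f y)%:M.
  by apply/matrixP=> i j; rewrite !mxE !ord1 !mulr1n.
by rewrite /mx2 map_block_mx !s.
Qed.

Lemma map_emx (R S : comNzRingType) (f : R -> S) x X Y : f 0 = 0 ->
  map_mx f (emx x X Y) = emx (f x) (map_mx f X) (map_mx f Y).
Proof.
move=> f0; have s y : map_mx f (y%:M : 'M_1) = (f y)%:M.
  by apply/matrixP=> i j; rewrite !mxE !ord1 !mulr1n.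
have z m n : map_mx f (0 : 'M_(m, n)) = 0 by apply/matrixP=> i j; rewrite !mxE.
by rewrite /emx !map_block_mx s !z.
Qed.

Section Gauge.
Variable C : numFieldType.
Local Notation PS := (powser C).
Variables (laurent : fieldType) (of_ps : {rmorphism PS -> laurent}).
Hypothesis of_ps_eq0 : forall f, (of_ps f == 0) = (f == 0).
Hypothesis laurentP : forall x, exists p q, q != 0 /\ x = of_ps p / of_ps q.
Variable l_theta : derivation laurent.
Hypothesis l_theta_ps : forall f, l_theta (of_ps f) = of_ps (ps_theta f).
Local Notation lpoly := (lpoly of_ps).
Local Notation lpolyC := (lpolyC of_ps).
Local Notation T := (lpoly ('X : {poly C})).
Local Notation K := (ratfun C).
Local Notation expand := (expand of_ps_eq0).

Section OneBlock.
Variable lam : C.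
Hypothesis lam0 : lam != 0.
Local Notation a := (av of_ps lam).
Local Notation b := (bv of_ps lam).
Local Notation c := (cv of_ps lam).
Local Notation l := (lv of_ps lam).

(** This is H = S + D with D = diag(1, -1). As S and D have square 1, S H = H D, so the columns of H
    are eigenvectors of S; moreover H^2 = 2 (a + 1), which gives the inverse. *)
Definition gauge := mx2 (a + 1) b c (- (a + 1)).
Definition weight1 := 3 - l - b / (a + 1).
Definition weight2 := 3 + l + c / (a + 1).

Lemma bcE : b * c = 1 - a ^+ 2.
Proof. by rewrite -(first_integral of_ps_eq0 l_theta_ps lam0) addrC addKr. Qed.

Let a1 := av1_neq0 of_ps_eq0 lam.

Lemma gauge_unit : gauge \in unitmx.
Proof.
have n2 : 2 * (a + 1) != 0 by rewrite mulf_neq0 // (lnat_neq0 of_ps_eq0 1).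
suff : gauge *m ((2 * (a + 1))^-1 *: gauge) = 1%:M by case/mulmx1_unit.
rewrite -scalemxAr mx2M mx2Z -mx2_1; congr mx2.
- by rewrite bcE; field; rewrite a1 (lnat_neq0 of_ps_eq0 1).
- by ring.
- by ring.
- by rewrite mulrNN [c * b]mulrC bcE; field; rewrite a1 (lnat_neq0 of_ps_eq0 1).
Qed.

(** The transformed connection is diagonal because S satisfies theta S = [A, S], so the connection
    preserves its eigenlines. The diagonal entries are read off the diagonal of this identity; the
    other two entries hold modulo bc = 1 - a^2. *)
Lemma gauge_der :
  map_mx l_theta gauge = mx2 (3 - l) (- 1) (- 1) (3 + l) *m gauge
                         - gauge *m mx2 weight1 0 0 weight2.
Proof.
rewrite map_mx2 ?(der0 l_theta) // -scaleN1r !mx2M mx2Z mx2D.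
rewrite (derN l_theta) derD (der1 l_theta).
rewrite (av_bv_cv of_ps_eq0 l_theta_ps) (l_theta_bv of_ps_eq0 l_theta_ps lam0).
rewrite (l_theta_cv of_ps_eq0 l_theta_ps lam0) /weight1 /weight2.
have bc := bcE; have a0 := a1.
congr mx2; apply: (mulIf a0).
- by field.
- transitivity ((a + 1) * (2 * a - 2 * l * b) - (b * c - (1 - a ^+ 2))).
    by rewrite bc; ring.
  by field.
- transitivity ((a + 1) * (2 * l * c - 2 * a) + (b * c - (1 - a ^+ 2))).
    by rewrite bc; ring.
  by field.
- by field.
Qed.

Lemma gauge_torus :
  mx2 a b c (- a) *m gauge = gauge *m mx2 1 0 0 (- 1).
Proof.
rewrite !mx2M; have bc := bcE; congr mx2.
- by rewrite bc; ring.
- by ring.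
- by ring.
- by rewrite [c * b]mulrC bc; ring.
Qed.

Lemma torus_free (x : 'I_3 -> K) :
  \sum_(i < 3) [:: a; b; c]`_i * expand (x i) = 0 -> forall i, x i = 0.
Proof.
have e2 n : (n.+1%:R : laurent) != 0 := lnat_neq0 of_ps_eq0 n.
have K2 n : (n.+1%:R : K) != 0.
  by apply: contra (e2 n) => /eqP h; rewrite -(rmorph_nat expand) h rmorph0.
have [L LE] : exists L, expand L = l.
  exists (ratfun_cst lam * ratfun_tau C ^+ 6).
  by rewrite rmorphM rmorphXn expand_cst expand_tau exprVn.
have l0 : l != 0.
  rewrite /lv mulf_neq0 ?invr_neq0 ?expf_neq0 ?lpolyX_neq0 //.
  by rewrite (lpoly_eq0 of_ps_eq0) polyC_eq0.
have L0 : L != 0 by apply: contra l0 => /eqP h; rewrite -LE h rmorph0.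
rewrite !big_ord_recl big_ord0 /=.
set x0 := x _; set x1 := x _; set x2 := x _ => e.
(* Coefficients of the same combination on a, q = theta a and theta q, after substituting b = (p +
   q)/2, c = (p - q)/2 and p = (4a - theta q)/(2l). *)
pose X := x0 + (x1 + x2) / L; pose Y := (x1 - x2) / 2.
pose Z := - (x1 + x2) / (4 * L).
suff [X0 Y0 Z0] : [/\ X = 0, Y = 0 & Z = 0].
  have x12 : x1 = x2.
    by apply/eqP; rewrite -subr_eq0; move/eqP: Y0;
       rewrite /Y mulf_eq0 invr_eq0 (negPf (K2 1%N)) orbF.
  have x20 : x2 = 0.
    move/eqP: Z0; rewrite /Z x12 mulf_eq0 invr_eq0 mulf_eq0 (negPf L0).
    rewrite (negPf (K2 3%N)) !orbF oppr_eq0 -mulr2n -mulr_natl mulf_eq0.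
    by rewrite (negPf (K2 1%N)) => /eqP.
  have x00 : x0 = 0 by move: X0; rewrite /X x12 x20 addr0 mul0r addr0.
  move=> [[|[|[|]]] //= h].
  - by rewrite -[RHS]x00 /x0; congr x; apply: val_inj.
  - by rewrite -[RHS]x20 -x12 /x1; congr x; apply: val_inj.
  - by rewrite -[RHS]x20 /x2; congr x; apply: val_inj.
have {e} : expand X * a + expand Y * qv of_ps lam
    + expand Z * l_theta (qv of_ps lam) = 0.
  rewrite -[RHS]e /X /Y /Z !(rmorphM, rmorphD, rmorphN, fmorphV, rmorph_nat) LE.
  rewrite (l_theta_qv of_ps_eq0 l_theta_ps lam0) /bv /cv.
  by field; rewrite l0 (e2 1%N) (e2 3%N).
have [p1 [q1 [q10 E1]]] := expandP of_ps_eq0 X.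
have [p2 [q2 [q20 E2]]] := expandP of_ps_eq0 Y.
have [p3 [q3 [q30 E3]]] := expandP of_ps_eq0 Z.
rewrite E1 E2 E3 => e.
have := @theta_free_poly _ _ lam0 (p1 * (q2 * q3)) (p2 * (q1 * q3)) (p3 * (q1 * q2)).
have nz p : p != 0 -> of_ps (ps_poly p) != 0 by rewrite of_ps_eq0 ps_poly_eq0.
case=> [|/eqP + /eqP + /eqP].
  apply/eqP; rewrite -of_ps_eq0; apply/eqP.
  rewrite !rmorphD !rmorphM /= -[of_ps (ps_theta (ps_theta _))]l_theta_ps.
  move: (nz _ q10) (nz _ q20) (nz _ q30) e; rewrite /lpoly /qv /av /qser.
  move: (of_ps (ps_poly q1)) (of_ps (ps_poly q2)) (of_ps (ps_poly q3)).
  move=> y1 y2 y3 y10 y20 y30 e.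
  rewrite -[RHS](mulr0 (y1 * y2 * y3)) -e.
  by field; rewrite y10 y20 y30.
rewrite !mulf_eq0 !(negPf q10, negPf q20, negPf q30) !orbF.
move=> /eqP z1 /eqP z2 /eqP z3.
by split; apply: (fmorph_inj expand); rewrite rmorph0 ?E1 ?E2 ?E3 ?z1 ?z2 ?z3
  rmorph0 mul0r.
Qed.
End OneBlock.

Variables lam nu : C.
Hypothesis (lam0 : lam != 0) (nu0 : nu != 0).
Hypothesis indep : forall y z : int,
  lam * y%:~R + nu * z%:~R = 0 -> y = 0 /\ z = 0.

Local Notation row1 := (erow 0 1 (- 1) 0 0 : 'rV[laurent]_(_)).
Local Notation row2 := (erow 0 0 0 1 (- 1) : 'rV[laurent]_(_)).

Definition weights : 'rV[laurent]_(1 + (1 + 1 + (1 + 1))) :=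
  erow 0 (weight1 lam) (weight2 lam)
         (weight1 nu) (weight2 nu).

Lemma int_weight (w : 'rV[laurent]_(1 + (1 + 1 + (1 + 1)))) d k :
  (forall i, exists z : int, w 0 i = z%:~R) ->
  exists z : int, tweight w d 0 k = z%:~R.
Proof.
move=> wz; apply: (tweight_closed (S := fun x => exists z : int, x = z%:~R)) => //.
  by exists 0.
by move=> _ _ [y ->] [z ->]; exists (y + z); rewrite rmorphD.
Qed.

Lemma int_row1 i : exists z : int, row1 0 i = z%:~R.
Proof.
apply: (erowP (P := fun x => exists z : int, x = z%:~R)).
- by exists 0. - by exists 1. - by exists (- 1); rewrite rmorphN1.
- by exists 0. - by exists 0.
Qed.

Lemma int_row2 i : exists z : int, row2 0 i = z%:~R.
Proof.
apply: (erowP (P := fun x => exists z : int, x = z%:~R)).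
- by exists 0. - by exists 0. - by exists 0.
- by exists 1. - by exists (- 1); rewrite rmorphN1.
Qed.

Lemma regular_nat n : regular of_ps n%:R.
Proof. by rewrite -(rmorph_nat of_ps); exact: regular_ps. Qed.

(** The difference of the two weights has polar part (lam (y' - y) + nu (z' - z)) t^-6, nonzero by
    [indep], and the remainder is regular because a(0) + 1 = 2. *)
Lemma weights_no_exponential d i k (y y' z z' : int) :
  tweight row1 d 0 i = y%:~R -> tweight row1 d 0 k = y'%:~R ->
  tweight row2 d 0 i = z%:~R -> tweight row2 d 0 k = z'%:~R ->
  (y != y') || (z != z') ->
  forall c, l_theta c = (tweight weights d 0 i - tweight weights d 0 k) * c ->
  c = 0.
Proof.
move=> yE y'E zE z'E ne.
pose bc x := bv of_ps x / (av of_ps x + 1).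
pose cc x := cv of_ps x / (av of_ps x + 1).
pose e := erow 0 (3 - bc lam) (3 + cc lam) (3 - bc nu) (3 + cc nu).
have wE : weights = - lv of_ps lam *: row1 + (- lv of_ps nu *: row2 + e).
  rewrite /e /bc /cc !erowZ !erowD /weights /weight1 /weight2.
  by congr erow; ring.
have re k' : regular of_ps (tweight e d 0 k').
  apply: tweight_closed; first by rewrite -(rmorph0 of_ps); exact: regular_ps.
    exact: regularD.
  have [r1 r1'] := regular_sum1 of_ps_eq0 lam.
  have [r2 r2'] := regular_sum1 of_ps_eq0 nu.
  have r3 := regular_nat 3.
  by apply: erowP; do ?[exact: (regular_nat 0) | apply: (regularD of_ps_eq0) => // |
    exact: regularN].
have rd : regular of_ps (tweight e d 0 i - tweight e d 0 k).
  by apply: (regularD of_ps_eq0) => //; exact: regularN.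
have k0 : lam * (y' - y)%:~R + nu * (z' - z)%:~R != 0.
  apply: contraL ne => /eqP /indep [/eqP + /eqP].
  by rewrite !subr_eq0 (eq_sym y') (eq_sym z') => -> ->.
move=> c ce; apply: (no_exponential of_ps_eq0 laurentP l_theta_ps k0 rd).
rewrite ce; congr (_ * _).
rewrite wE !tweightD !tweightZ !mxE yE y'E zE z'E /lv.
rewrite rmorphD !rmorphM !rmorph_int !rmorphB /=.
by move: (lpolyC lam) (lpolyC nu) (_ ^- 6) => *; ring.
Qed.

Variables (L : fieldType) (dL : derivation L) (io : {rmorphism K -> L}).
Hypothesis io_der : forall x, dL (io x) = io (r_theta C x).

Definition block_mx_of (x : C) : 'M[K]_(1 + 1) :=
  let l := ratfun_cst x * ratfun_tau C ^+ 6 in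
  mx2 (3 - l) (- 1) (- 1) (3 + l).

Definition extended_mx := emx 0 (block_mx_of lam) (block_mx_of nu).

Variable F : 'M[L]_(1 + (1 + 1 + (1 + 1))).
Hypothesis solF : map_mx dL F = map_mx io extended_mx *m F.

Definition ext_gauge := emx 1 (gauge lam) (gauge nu).

Lemma ext_gauge_unit : ext_gauge \in unitmx.
Proof.
have [u1 u2] := (gauge_unit lam0, gauge_unit nu0).
suff : ext_gauge *m emx 1 (invmx (gauge lam)) (invmx (gauge nu)) = 1%:M.
  by case/mulmx1_unit.
by rewrite emxM mulr1 !mulmxV ?emx1.
Qed.

Lemma expand_block x : map_mx expand (block_mx_of x) =
  mx2 (3 - lv of_ps x) (- 1) (- 1) (3 + lv of_ps x).
Proof.
have lE : expand (ratfun_cst x * ratfun_tau C ^+ 6) = lv of_ps x.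
  by rewrite rmorphM rmorphXn expand_cst expand_tau exprVn.
have E3 : expand 3 = 3 by exact: rmorph_nat.
have E1 : expand (- 1) = - 1 by exact: rmorphN1.
by rewrite map_mx2 ?rmorph0 // rmorphB [expand (3 + _)]rmorphD lE E3 E1.
Qed.

Lemma ext_gauge_der : map_mx l_theta ext_gauge =
  map_mx expand extended_mx *m ext_gauge - ext_gauge *m diag_mx weights.
Proof.
rewrite diag_erow !map_emx ?rmorph0 ?(der0 l_theta) // !expand_block.
rewrite !gauge_der // !emxM emxN emxD mul0r mulr0 subr0.
by rewrite (der1 l_theta).
Qed.

Lemma sum3 (a b c : laurent) n (X Y Z : 'M[K]_n) :
  \sum_(i < 3) [:: a; b; c]`_i *: map_mx expand [:: X; Y; Z]`_i =
  a *: map_mx expand X + (b *: map_mx expand Y + c *: map_mx expand Z).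
Proof. by rewrite !big_ord_recl big_ord0 addr0. Qed.

Lemma expand_mx2 a b c d :
  map_mx expand (mx2 a b c d) = mx2 (expand a) (expand b) (expand c) (expand d).
Proof. by rewrite map_mx2 // rmorph0. Qed.

Lemma expand_sl2 (a b c : laurent) :
  a *: map_mx expand (mx2 1 0 0 (- 1)) + (b *: map_mx expand (mx2 0 1 0 0)
    + c *: map_mx expand (mx2 0 0 1 0)) = mx2 a b c (- a).
Proof.
rewrite !expand_mx2 rmorph0 rmorphN1 rmorph1 !mx2Z !mx2D.
by congr mx2; ring.
Qed.

Lemma sum_block1 (a b c : laurent) :
  \sum_(i < 3) [:: a; b; c]`_i *: map_mx expand
    [:: emx 0 (mx2 1 0 0 (- 1)) 0; emx 0 (mx2 0 1 0 0) 0; emx 0 (mx2 0 0 1 0) 0]`_i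
  = emx 0 (mx2 a b c (- a)) 0.
Proof.
have E k x : k *: map_mx expand (emx 0 x 0) = emx 0 (k *: map_mx expand x) 0.
  by rewrite map_emx ?rmorph0 // emxZ mulr0 scaler0.
by rewrite sum3 (E a) (E b) (E c) emx_sum1 expand_sl2.
Qed.

Lemma sum_block2 (a b c : laurent) :
  \sum_(i < 3) [:: a; b; c]`_i *: map_mx expand
    [:: emx 0 0 (mx2 1 0 0 (- 1)); emx 0 0 (mx2 0 1 0 0); emx 0 0 (mx2 0 0 1 0)]`_i
  = emx 0 0 (mx2 a b c (- a)).
Proof.
have E k x : k *: map_mx expand (emx 0 0 x) = emx 0 0 (k *: map_mx expand x).
  by rewrite map_emx ?rmorph0 // emxZ mulr0 scaler0.
by rewrite sum3 (E a) (E b) (E c) emx_sum2 expand_sl2.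
Qed.

(** Of the three components of S only those carried by b and c, at indices 1 and 2, are retained:
    they are nilpotent, and their one-parameter groups generate SL2. *)
Lemma relation_block1 d (c : 'M[K]_(tdim _ d)) x :
  x = mx2 0 1 0 0 \/ x = mx2 0 0 1 0 ->
  relation io F c -> relation io F (c *m tder 1%:M (emx 0 x 0) d).
Proof.
pose s (i : 'I_3) : 'M[K]_(1 + (1 + 1 + (1 + 1))) :=
  [:: emx 0 (mx2 1 0 0 (- 1)) 0; emx 0 (mx2 0 1 0 0) 0; emx 0 (mx2 0 0 1 0) 0]`_i.
have sH : (\sum_(i < 3) [:: av of_ps lam; bv of_ps lam; cv of_ps lam]`_i
     *: map_mx expand (s i)) *m ext_gauge = ext_gauge *m diag_mx row1.
  rewrite /s sum_block1 diag_erow mx2_0 /ext_gauge !emxM mul0r mulr0 mul0mx mulmx0.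
  by rewrite gauge_torus.
have fr (y : 'I_3 -> K) : \sum_(i < 3)
    [:: av of_ps lam; bv of_ps lam; cv of_ps lam]`_i * expand (y i) = 0 ->
    forall i, y i = 0 by exact: torus_free.
have nx d' (i k : 'I_(tdim (1 + (1 + 1 + (1 + 1))) d')) :
    tweight row1 d' 0 i != tweight row1 d' 0 k ->
    forall c, l_theta c = (tweight weights d' 0 i - tweight weights d' 0 k) * c ->
    c = 0.
  have [y yE] := int_weight i int_row1; have [y' y'E] := int_weight k int_row1.
  have [z zE] := int_weight i int_row2; have [z' z'E] := int_weight k int_row2.
  move=> ne; apply: (weights_no_exponential yE y'E zE z'E).
  by apply/orP; left; apply: contraNneq ne => yy; rewrite yE y'E yy.
have tor := relation_torus (expand_theta of_ps_eq0 l_theta_ps) io_der solF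
  ext_gauge_unit ext_gauge_der sH fr nx.
case=> ->; first exact: (tor _ _ (Ordinal (isT : 1 < 3)%N)).
exact: (tor _ _ (Ordinal (isT : 2 < 3)%N)).
Qed.

Lemma relation_block2 d (c : 'M[K]_(tdim _ d)) x :
  x = mx2 0 1 0 0 \/ x = mx2 0 0 1 0 ->
  relation io F c -> relation io F (c *m tder 1%:M (emx 0 0 x) d).
Proof.
pose s (i : 'I_3) : 'M[K]_(1 + (1 + 1 + (1 + 1))) :=
  [:: emx 0 0 (mx2 1 0 0 (- 1)); emx 0 0 (mx2 0 1 0 0); emx 0 0 (mx2 0 0 1 0)]`_i.
have sH : (\sum_(i < 3) [:: av of_ps nu; bv of_ps nu; cv of_ps nu]`_i
     *: map_mx expand (s i)) *m ext_gauge = ext_gauge *m diag_mx row2.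
  rewrite /s sum_block2 diag_erow mx2_0 /ext_gauge !emxM mul0r mulr0 mul0mx mulmx0.
  by rewrite gauge_torus.
have fr (y : 'I_3 -> K) : \sum_(i < 3)
    [:: av of_ps nu; bv of_ps nu; cv of_ps nu]`_i * expand (y i) = 0 ->
    forall i, y i = 0 by exact: torus_free.
have nx d' (i k : 'I_(tdim (1 + (1 + 1 + (1 + 1))) d')) :
    tweight row2 d' 0 i != tweight row2 d' 0 k ->
    forall c, l_theta c = (tweight weights d' 0 i - tweight weights d' 0 k) * c ->
    c = 0.
  have [y yE] := int_weight i int_row1; have [y' y'E] := int_weight k int_row1.
  have [z zE] := int_weight i int_row2; have [z' z'E] := int_weight k int_row2.
  move=> ne; apply: (weights_no_exponential yE y'E zE z'E).
  by apply/orP; right; apply: contraNneq ne => zz; rewrite zE z'E zz.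
have tor := relation_torus (expand_theta of_ps_eq0 l_theta_ps) io_der solF
  ext_gauge_unit ext_gauge_der sH fr nx.
case=> ->; first exact: (tor _ _ (Ordinal (isT : 1 < 3)%N)).
exact: (tor _ _ (Ordinal (isT : 2 < 3)%N)).
Qed.

End Gauge.

(** * Invariance under SL2 x SL2 *)

Section PolynomialValues.
Variables (K L : fieldType) (io : {rmorphism K -> L}) (n : nat).

Definition pval (f : mpoly (n * n) K) (X : 'M[L]_n) : L :=
  meval (fun k => mxvec X 0 k) (map_mpoly io f).

Definition homog (X : 'M[L]_n) : 'M[L]_(1 + n) := block_mx 1 0 0 X.

(** The corner entry 1 of [homog X] supplies the missing factors when the monomial has degree less
    than d. *)
Lemma monomial_tpow d (m : multinom (n * n)) : (mdeg m <= d)%N ->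
  exists p q, forall X, pval (mpolyX K m) X = tpow (homog X) d p q.
Proof.
elim: d m => [|d IH] m.
  rewrite leqn0 mdeg_eq0 => /eqP ->; exists ord0, ord0 => X.
  by rewrite /pval map_mpolyX mpolyX0 rmorph1 /= mxE.
have [->|m0] := eqVneq m mnm0.
  have [|p [q pq]] := IH mnm0; first by rewrite mdeg0.
  move=> _; exists (mxtens_index (lshift n 0, p)), (mxtens_index (lshift n 0, q)) => X.
  by rewrite pq tensmxE /homog block_mxEul mxE mul1r.
have [i mi] : exists i, m i != 0%N.
  apply/existsP; rewrite -negb_forall; apply: contra m0 => /forallP h.
  by apply/eqP/mnmP=> i; rewrite mnm0E; apply/eqP.
have mE : m = mnm_add (mnm1 i) (mnm_sub m (mnm1 i)).
  apply/mnmP=> k; rewrite mnmDE mnmBE mnm1E.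
  by case: eqP => [<-|_]; rewrite ?subn0 // subnKC // lt0n.
rewrite mE mdegD mdeg1 add1n ltnS => le.
have [p [q pq]] := IH _ le; case/mxvec_indexP: {m0 mi mE le} i pq => r c pq.
exists (mxtens_index (rshift 1 r, p)), (mxtens_index (rshift 1 c, q)) => X.
rewrite tensmxE /homog block_mxEdr -pq /pval !map_mpolyX mpolyXD rmorphM /=.
by rewrite mevalXU mxvecE.
Qed.

Lemma pval_relation f : exists d (c : 'M[K]_(tdim (1 + n) d)),
  forall X, pval f X = \tr (map_mx io c *m tpow (homog X) d).
Proof.
exists (msize f).
have [c cE] : exists c : 'M[K]_(tdim (1 + n) (msize f)), forall X,
    \sum_(m <- msupp f) io (mcoeff m f) * pval (mpolyX K m) X =
    \tr (map_mx io c *m tpow (homog X) (msize f)).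
  have: all (fun m => mdeg m <= msize f)%N (msupp f).
    by apply/allP=> m /msize_mdeg_lt/ltnW.
  elim: (msupp f) => [_|m s IH /= /andP[le /IH[c cE]]].
    by exists 0 => X; rewrite big_nil map_mx0 mul0mx mxtrace0.
  have [p [q pq]] := monomial_tpow le.
  exists (mcoeff m f *: delta_mx q p + c) => X.
  rewrite big_cons cE map_mxD mulmxDl mxtraceD map_mxZ -scalemxAl mxtraceZ pq.
  congr (_ * _ + _); rewrite map_delta_mx /mxtrace (bigD1 q) //= big1 ?addr0.
    rewrite !mxE (bigD1 p) //= big1 ?addr0 => [|k kp].
      by rewrite mxE !eqxx mul1r.
    by rewrite mxE (negPf kp) andbF mul0r.
  move=> k kq; rewrite mxE big1 // => l _.
  by rewrite mxE (negPf kq) mul0r.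
exists c => X; rewrite -cE {1}/pval [in LHS](mpolyE f).
rewrite (raddf_sum (map_mpoly io)) (raddf_sum (meval _)) /=.
by apply: eq_bigr => m _; rewrite map_mpolyZ mevalZ.
Qed.

End PolynomialValues.

Section SL2Generation.
Variable R : fieldType.

Lemma sl2_elementary (a b c d : R) : a * d - b * c = 1 -> exists s x u y,
  mx2 a b c d =
  mx2 1 0 s 1 *m (mx2 1 x 0 1 *m (mx2 1 0 u 1 *m mx2 1 y 0 1)).
Proof.
have gen (a' b' c' d' : R) : c' != 0 -> a' * d' - b' * c' = 1 ->
    mx2 a' b' c' d' = mx2 1 ((a' - 1) / c') 0 1 *m
      (mx2 1 0 c' 1 *m mx2 1 ((d' - 1) / c') 0 1).
  move=> c0 e; rewrite !mx2M; congr mx2.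
  - by field.
  - apply: (mulIf c0); transitivity (a' * d' - (a' * d' - b' * c')); first by ring.
    by rewrite e; field.
  - by ring.
  - by field.
move=> e; have [c0|c0] := eqVneq c 0.
  have a0 : a != 0.
    apply: contra_eq_neq e => ->; rewrite c0 mul0r mulr0 subr0 eq_sym.
    exact: oner_neq0.
  (* When c = 0, adding the first row to the second puts a, which is nonzero, in the lower left
     corner; the first factor, with parameter -1, undoes this. *)
  exists (- 1), ((a - 1) / a), a, ((d + b - 1) / a).
  rewrite -(gen a b a (d + b)) //; last by rewrite -e c0; ring.
  by rewrite mx2M; congr mx2; rewrite ?c0; ring.
exists 0, ((a - 1) / c), c, ((d - 1) / c).
by rewrite -(gen a b c d) // mx2M; congr mx2; ring.
Qed.
End SL2Generation.

Section Density.
Variable C : numFieldType.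
Local Notation K := (ratfun C).
Variables lam nu : C.
Hypothesis (lam0 : lam != 0) (nu0 : nu != 0).
Hypothesis indep : forall y z : int,
  lam * y%:~R + nu * z%:~R = 0 -> y = 0 /\ z = 0.
Variables (L : fieldType) (dL : derivation L) (io : {rmorphism K -> L}).
Hypothesis io_der : forall x, dL (io x) = io (r_theta C x).
Variable F : 'M[L]_(1 + (1 + 1 + (1 + 1))).
Hypothesis solF : map_mx dL F = map_mx io (extended_mx lam nu) *m F.

Lemma relation_elementary d (c : 'M[K]_(tdim _ d)) x y :
  [\/ x = mx2 0 1 0 0 /\ y = 0, x = mx2 0 0 1 0 /\ y = 0,
      x = 0 /\ y = mx2 0 1 0 0 | x = 0 /\ y = mx2 0 0 1 0] ->
  relation io F c -> relation io F (c *m tder 1%:M (emx 0 x y) d).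
Proof.
(* The Laurent field, abstract so far, is now realised as the fraction field of power series. *)
have e0 f : ((@tofrac (powser C) f : {fraction powser C}) == 0) = (f == 0).
  exact: tofrac_eq0.
have fP := @fracP (powser C).
have th := frac_der_tofrac (@ps_thetaD C) (@ps_thetaM C).
have B1 := @relation_block1 C _ _ e0 fP _ th lam nu lam0 nu0 indep _ _ _ io_der F solF.
have B2 := @relation_block2 C _ _ e0 fP _ th lam nu lam0 nu0 indep _ _ _ io_der F solF.
by case=> -[-> ->]; [apply: B1; left|apply: B1; right|apply: B2; left|apply: B2; right].
Qed.

Definition relations_vanish (X : 'M[L]_(1 + (1 + 1 + (1 + 1)))) :=
  forall d (c : 'M[K]_(tdim _ d)), relation io F c ->
    \tr (map_mx io c *m tpow X d) = 0.

Lemma pchar0_ext : [pchar L] =i pred0.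
Proof.
apply/pcharf0P => n; rewrite -(rmorph_nat io) fmorph_eq0.
rewrite -(rmorph_nat (@tofrac {poly C})) tofrac_eq0.
by rewrite -polyC_natr polyC_eq0 pnatr_eq0.
Qed.

Lemma vanish_elementary X x y t : relations_vanish X ->
  [\/ x = mx2 0 1 0 0 /\ y = 0, x = mx2 0 0 1 0 /\ y = 0,
      x = 0 /\ y = mx2 0 1 0 0 | x = 0 /\ y = mx2 0 0 1 0] ->
  relations_vanish ((1%:M + t *: map_mx io (emx 0 x y)) *m X).
Proof.
move=> vX xy d c rc.
apply: (@relation_unipotent _ _ io _ d pchar0_ext (@relation _ _ io _ F d)) => //.
- rewrite emxM mulr0; have z : mx2 0 0 0 0 = 0 :> 'M[K]_(1 + 1) := mx2_0 _.
  by case: xy => -[-> ->]; rewrite ?mul0mx ?mx2M ?(mulr0, mul0r, mulr1, addr0) ?z emx0.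
- by move=> e; apply: relation_elementary.
- exact: vX.
Qed.

Lemma map_mx2_rmorph a b c d : map_mx io (mx2 a b c d) = mx2 (io a) (io b) (io c) (io d).
Proof. by rewrite map_mx2 // rmorph0. Qed.

Lemma map_emx_rmorph x X Y :
  map_mx io (emx x X Y) = emx (io x) (map_mx io X) (map_mx io Y).
Proof. by rewrite map_emx // rmorph0. Qed.

Lemma elementary_emx t x y : 1%:M + t *: map_mx io (emx 0 x y) =
  emx 1 (1%:M + t *: map_mx io x) (1%:M + t *: map_mx io y).
Proof. by rewrite map_emx_rmorph rmorph0 emxZ -emx1 emxD mulr0 addr0. Qed.

Lemma elementary_mx2 t : 1%:M + t *: map_mx io (mx2 0 1 0 0) = mx2 1 t 0 1 /\
  1%:M + t *: map_mx io (mx2 0 0 1 0) = mx2 1 0 t 1.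
Proof.
rewrite !map_mx2_rmorph (rmorph0 io) (rmorph1 io) !mx2Z -mx2_1 !mx2D.
by rewrite !mulr0 !mulr1 !addr0 !add0r.
Qed.

Lemma elementary_0 t : 1%:M + t *: map_mx io 0 = 1%:M :> 'M[L]_(1 + 1).
Proof.
have -> : map_mx io 0 = 0 :> 'M_(1 + 1) by apply/matrixP=> i j; rewrite !mxE rmorph0.
by rewrite scaler0 addr0.
Qed.

(** The entries range over L because the lemma is meant for conjugates of constant matrices by
    fundamental matrices. Each factor is reached by at most four elementary steps. *)
Lemma vanish_sl2 X a b c d a' b' c' d' : relations_vanish X ->
  a * d - b * c = 1 -> a' * d' - b' * c' = 1 ->
  relations_vanish (emx 1 (mx2 a b c d) (mx2 a' b' c' d') *m X).
Proof.
move=> vX /sl2_elementary[s [x [u [y ->]]]] /sl2_elementary[s' [x' [u' [y' ->]]]].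
have U1 t Y : relations_vanish Y -> relations_vanish (emx 1 (mx2 1 t 0 1) 1%:M *m Y).
  move=> vY; have [e _] := elementary_mx2 t.
  by rewrite -e -[X in emx _ _ X](elementary_0 t) -elementary_emx;
    apply: vanish_elementary => //; constructor 1.
have L1 t Y : relations_vanish Y -> relations_vanish (emx 1 (mx2 1 0 t 1) 1%:M *m Y).
  move=> vY; have [_ e] := elementary_mx2 t.
  by rewrite -e -[X in emx _ _ X](elementary_0 t) -elementary_emx;
    apply: vanish_elementary => //; constructor 2.
have U2 t Y : relations_vanish Y -> relations_vanish (emx 1 1%:M (mx2 1 t 0 1) *m Y).
  move=> vY; have [e _] := elementary_mx2 t.
  by rewrite -e -[X in emx _ X _](elementary_0 t) -elementary_emx;
    apply: vanish_elementary => //; constructor 3.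
have L2 t Y : relations_vanish Y -> relations_vanish (emx 1 1%:M (mx2 1 0 t 1) *m Y).
  move=> vY; have [_ e] := elementary_mx2 t.
  by rewrite -e -[X in emx _ X _](elementary_0 t) -elementary_emx;
    apply: vanish_elementary => //; constructor 4.
have := L1 s _ (U1 x _ (L1 u _ (U1 y _ (L2 s' _ (U2 x' _ (L2 u' _ (U2 y' _ vX))))))).
by rewrite !mulmxA !emxM !mul1r !mul1mx !mulmx1 -!mulmxA.
Qed.

End Density.

Section PolynomialDensity.
Variable C : numFieldType.
Local Notation K := (ratfun C).
Variables lam nu : C.
Hypothesis (lam0 : lam != 0) (nu0 : nu != 0).
Hypothesis indep : forall y z : int,
  lam * y%:~R + nu * z%:~R = 0 -> y = 0 /\ z = 0.
Variables (L : fieldType) (dL : derivation L) (io : {rmorphism K -> L}).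
Hypothesis io_der : forall x, dL (io x) = io (r_theta C x).

Definition pair_mx : 'M[K]_(1 + 1 + (1 + 1)) :=
  block_mx (block_mx_of lam) 0 0 (block_mx_of nu).

Variable F : 'M[L]_(1 + 1 + (1 + 1)).
Hypothesis solF : map_mx dL F = map_mx io pair_mx *m F.

Theorem pval_sl2 f a b c d a' b' c' d' : pval io f F = 0 ->
  a * d - b * c = 1 -> a' * d' - b' * c' = 1 ->
  pval io f (block_mx (mx2 a b c d) 0 0 (mx2 a' b' c' d') *m F) = 0.
Proof.
have [e [g gE]] := pval_relation io f; rewrite !gE => rF ad ad'.
have homogM A (X : 'M[L]_(1 + 1 + (1 + 1))) : homog (A *m X) = homog A *m homog X.
  by rewrite /homog mulmx_block !(mulmx0, mul0mx) !addr0 !add0r mulmx1.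
have d0 m n : map_mx dL (0 : 'M_(m, n)) = 0.
  by apply/matrixP=> i j; rewrite !mxE (der0 dL).
have solH : map_mx dL (homog F) = map_mx io (extended_mx lam nu) *m homog F.
  have -> : map_mx io (extended_mx lam nu) = block_mx 0 0 0 (map_mx io pair_mx).
    by rewrite /extended_mx /emx map_block_mx !map_mx0 raddf0 map_mx0.
  rewrite /homog map_block_mx mulmx_block !(mulmx0, mul0mx) !addr0 add0r -solF !d0.
  by rewrite (map_der1 (@derD _ dL) (@derM _ dL)).
have v0 : relations_vanish io (homog F) (homog F) by move=> k h.
have := vanish_sl2 lam0 nu0 indep io_der solH v0 ad ad' rF.
by rewrite homogM.
Qed.
End PolynomialDensity.

(** * Automorphisms from relations *)

Section PvalMorphism.
Variables (K L : fieldType) (io : {rmorphism K -> L}) (n : nat) (X : 'M[L]_n).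

Lemma pvalB f g : pval io (f - g) X = pval io f X - pval io g X.
Proof. by rewrite /pval !rmorphB. Qed.
Lemma pvalM f g : pval io (f * g) X = pval io f X * pval io g X.
Proof. by rewrite /pval !rmorphM. Qed.
Lemma pval1 : pval io 1 X = 1.
Proof. by rewrite /pval !rmorph1. Qed.
Lemma pvalC a : pval io (mpolyC _ a) X = io a.
Proof. by rewrite /pval map_mpolyC mevalC. Qed.
Lemma pvalX i j : pval io (mpolyX K (mnm1 (mxvec_index i j))) X = X i j.
Proof. by rewrite /pval map_mpolyX mevalXU mxvecE. Qed.
End PvalMorphism.

Section AutomorphismFromRelations.
Variables (K L : fieldType) (dK : derivation K) (dL : derivation L).
Variables (io : {rmorphism K -> L}) (n : nat) (A : 'M[K]_n) (F : 'M[L]_n).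
Hypothesis hPV : picard_vessiot dK A dL io F.
Variable N : 'M[K]_n.
Hypothesis uN : N \in unitmx.
Hypothesis dN : map_mx dK N = 0.
Let FN := F *m map_mx io N.
Hypothesis relFN : forall f, pval io f F = 0 <-> pval io f FN = 0.

Let pval_neq0 g : pval io g F != 0 -> pval io g FN != 0.
Proof. by apply: contra => /eqP/relFN/eqP. Qed.

(** Graph of the automorphism sought, f(F)/g(F) -> f(FN)/g(FN). A relation is used because one
    element of L has many such fractions. *)
Definition conj_pair x y := exists f g, [/\ pval io g F != 0,
  x = pval io f F / pval io g F & y = pval io f FN / pval io g FN].

Lemma conj_pair_eq0 x y : conj_pair x y -> x = 0 -> y = 0.
Proof.
move=> [f [g [g0 -> ->]]] /eqP; rewrite mulf_eq0 invr_eq0 (negPf g0) orbF.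
by move=> /eqP/relFN ->; rewrite mul0r.
Qed.

Lemma conj_pairB x y x' y' :
  conj_pair x y -> conj_pair x' y' -> conj_pair (x - x') (y - y').
Proof.
move=> [f [g [g0 -> ->]]] [f' [g' [g'0 -> ->]]].
have [h0 h'0] := (pval_neq0 g0, pval_neq0 g'0).
exists (f * g' - f' * g), (g * g'); rewrite !pvalB !pvalM; split.
- by rewrite mulf_neq0.
- by rewrite -mulNr addf_div // mulNr.
- by rewrite -mulNr addf_div // mulNr.
Qed.

Lemma conj_pairM x y x' y' :
  conj_pair x y -> conj_pair x' y' -> conj_pair (x * x') (y * y').
Proof.
move=> [f [g [g0 -> ->]]] [f' [g' [g'0 -> ->]]].
exists (f * f'), (g * g'); rewrite !pvalM; split.
- by rewrite mulf_neq0.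
- by rewrite mulf_div.
- by rewrite mulf_div.
Qed.

Lemma conj_pairV x y : conj_pair x y -> conj_pair x^-1 y^-1.
Proof.
move=> xy; have [f [g [g0 xE yE]]] := xy.
have [x0|x0] := eqVneq x 0.
  by move: (xy); rewrite (conj_pair_eq0 xy x0) x0 invr0.
exists g, f; rewrite xE yE !invf_div; split=> //.
by apply: contra x0; rewrite xE => /eqP ->; rewrite mul0r.
Qed.

Lemma conj_pair_base a : conj_pair (io a) (io a).
Proof.
exists (mpolyC _ a), 1; rewrite !pval1 !pvalC !divr1.
by split=> //; exact: oner_neq0.
Qed.

Lemma conj_pair_entry i j : conj_pair (F i j) (FN i j).
Proof.
exists (mpolyX K (mnm1 (mxvec_index i j))), 1; rewrite !pval1 !pvalX !divr1.
by split=> //; exact: oner_neq0.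
Qed.

(** The elements occurring in the graph form a division ring that contains K and the entries of F,
    hence all of L by the minimality of a Picard-Vessiot extension. *)
Lemma conj_pair_total x : exists y, conj_pair x y.
Proof.
apply/asboolP; apply: (pv_gen hPV (S := [pred x | `[< exists y, conj_pair x y >]])).
- split.
  + by apply/asboolP; exists (io 1); rewrite -(rmorph1 io); exact: conj_pair_base.
  + move=> u v /asboolP[u' uu] /asboolP[v' vv]; apply/asboolP.
    by exists (u' - v'); exact: conj_pairB.
  + move=> u v /asboolP[u' uu] /asboolP[v' vv]; apply/asboolP.
    by exists (u' / v'); apply: conj_pairM => //; exact: conj_pairV.
- by move=> a; apply/asboolP; exists (io a); exact: conj_pair_base.
- by move=> i j; apply/asboolP; exists (FN i j); exact: conj_pair_entry.
Qed.

Lemma conj_pair_fun x y y' : conj_pair x y -> conj_pair x y' -> y = y'.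
Proof.
move=> xy xy'; apply/eqP; rewrite -subr_eq0; apply/eqP.
by apply: conj_pair_eq0 (conj_pairB xy xy') _; rewrite subrr.
Qed.

Definition conj_fun x := sval (cid (conj_pair_total x)).

Lemma conj_funP x y : conj_pair x y -> conj_fun x = y.
Proof. by apply: conj_pair_fun; exact: svalP (cid (conj_pair_total x)). Qed.

Lemma conj_fun_pair x : conj_pair x (conj_fun x).
Proof. exact: svalP (cid (conj_pair_total x)). Qed.

Fact conj_fun_zmod : zmod_morphism conj_fun.
Proof. by move=> x y; apply: conj_funP; apply: conj_pairB; exact: conj_fun_pair. Qed.

Fact conj_fun_monoid : monoid_morphism conj_fun.
Proof.
split; first by rewrite -(rmorph1 io); apply: conj_funP; exact: conj_pair_base.
by move=> x y; apply: conj_funP; apply: conj_pairM; exact: conj_fun_pair.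
Qed.

HB.instance Definition _ := GRing.isZmodMorphism.Build L L conj_fun conj_fun_zmod.
HB.instance Definition _ := GRing.isMonoidMorphism.Build L L conj_fun conj_fun_monoid.

Lemma automorphism_of_relations : exists2 s : {rmorphism L -> L},
  diff_automorphism dL io s & map_mx s F = F *m map_mx io N.
Proof.
pose s : {rmorphism L -> L} := conj_fun.
have sK a : s (io a) = io a by apply: conj_funP; exact: conj_pair_base.
have sF : map_mx s F = FN.
  by apply/matrixP=> i j; rewrite mxE; apply: conj_funP; exact: conj_pair_entry.
exists s => //.
have sd x : s (dL x) = dL (s x).
  apply/eqP; apply: (pv_gen hPV (S := [pred x | s (dL x) == dL (s x)])).
  - split=> [|u v /eqP eu /eqP ev'|u v /eqP eu /eqP ev']; apply/eqP.
    + by rewrite rmorph1 (der1 dL) rmorph0.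
    + by rewrite (derB dL) !rmorphB (derB dL) eu ev'.
    + have [->|v0] := eqVneq v 0; first by rewrite invr0 mulr0 (der0 dL) rmorph0 (der0 dL).
      have sv0 : s v != 0 by rewrite fmorph_eq0.
      rewrite (der_div dL) // fmorph_div rmorphXn rmorphB !rmorphM eu ev'.
      by rewrite fmorphV (der_div dL).
  - by move=> a; apply/eqP; rewrite (pv_der hPV) !sK (pv_der hPV).
  - move=> i j; apply/eqP.
    have -> : dL (F i j) = (map_mx io A *m F) i j by rewrite -(pv_sol hPV) mxE.
    have -> : s (F i j) = FN i j by rewrite -sF mxE.
    have -> : dL (FN i j) = (map_mx dL FN) i j by rewrite [RHS]mxE.
    have -> : s ((map_mx io A *m F) i j) = (map_mx s (map_mx io A *m F)) i j.
      by rewrite [RHS]mxE.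
    rewrite /FN (map_derM (@derD _ dL) (@derM _ dL)) (pv_sol hPV) map_mxM sF.
    have -> : map_mx dL (map_mx io N) = map_mx io (map_mx dK N).
      by apply/matrixP=> k l; rewrite !mxE (pv_der hPV).
    rewrite dN map_mx0 mulmx0 addr0 /FN mulmxA.
    have -> // : map_mx s (map_mx io A) = map_mx io A.
    by apply/matrixP=> k l; rewrite !mxE sK.
split=> //.
have surj x : exists y, s y = x.
  apply/asboolP; apply: (pv_gen hPV (S := [pred x | `[< exists y, s y = x >]])).
  - split.
    + by apply/asboolP; exists 1; rewrite rmorph1.
    + move=> u v /asboolP[u' <-] /asboolP[v' <-]; apply/asboolP.
      by exists (u' - v'); rewrite rmorphB.
    + move=> u v /asboolP[u' <-] /asboolP[v' <-]; apply/asboolP.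
      by exists (u' / v'); rewrite fmorph_div.
  - by move=> a; apply/asboolP; exists (io a).
  (* The automorphism sends F N^-1 to F N N^-1 = F, since it fixes the entries of N. *)
  - move=> i j; apply/asboolP; exists ((F *m map_mx io (invmx N)) i j).
    have -> : s ((F *m map_mx io (invmx N)) i j) =
        map_mx s (F *m map_mx io (invmx N)) i j by rewrite [RHS]mxE.
    rewrite map_mxM sF.
    have -> : map_mx s (map_mx io (invmx N)) = map_mx io (invmx N).
      by apply/matrixP=> k l; rewrite !mxE sK.
    by rewrite /FN -mulmxA -map_mxM mulmxV // map_mx1 mulmx1.
pose t x := sval (cid (surj x)).
have st : cancel t s by move=> x; exact: svalP (cid (surj x)).
exists t => // x; apply: (fmorph_inj s); exact: st.
Qed.

End AutomorphismFromRelations.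

(** * Constants and splitting *)

Lemma deriv_eq0 (C : numFieldType) (p : {poly C}) : p^`() = 0 -> p = (p`_0)%:P.
Proof.
move=> e; apply/polyP=> i; rewrite coefC; case: i => [//|i] /=.
have := congr1 (coefp i) e; rewrite /= coef0 coef_deriv => /eqP.
by rewrite -mulr_natl mulf_eq0 pnatr_eq0 => /eqP.
Qed.

(** For p/q in lowest terms, p'q = pq' makes q divide q', which is impossible by degree unless q' =
    0; then p' = 0 as well. *)
Lemma ratfun_constant (C : numFieldType) (x : ratfun C) :
  ratfun_der C x = 0 -> exists c, x = ratfun_cst c.
Proof.
have [p0 [q0 [q00 xE]]] := fracP x.
pose g := gcdp p0 q0; pose p := p0 %/ g; pose q := q0 %/ g.
have pE : p0 = p * g by rewrite divpK // dvdp_gcdl.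
have qE : q0 = q * g by rewrite divpK // dvdp_gcdr.
have g0 : g != 0 by apply: contraNneq q00 => h; rewrite qE h mulr0.
have qn0 : q != 0 by apply: contraNneq q00 => h; rewrite qE h mul0r.
have cpq : coprimep q p by rewrite coprimep_sym coprimep_div_gcd // q00 orbT.
have {}xE : x = tofrac p / tofrac q.
  by rewrite xE pE qE !tofracM -mulf_div divff ?mulr1 // tofrac_eq0.
rewrite xE /= ratfun_der_fracE // => /eqP.
rewrite mulf_eq0 invr_eq0 expf_eq0 /= !tofrac_eq0 (negPf qn0) orbF subr_eq0 => /eqP e.
have q'0 : q^`() = 0.
  have : q %| q^`() by rewrite -(Gauss_dvdpr _ cpq) -e dvdp_mull.
  apply: contraTeq => n0; apply/negP => /(dvdp_leq n0).
  by rewrite leqNgt lt_size_deriv.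
have p'0 : p^`() = 0.
  by move/eqP: e; rewrite q'0 mulr0 mulf_eq0 (negPf qn0) orbF => /eqP.
exists (p`_0 / q`_0); rewrite /ratfun_cst.
have q1 : q`_0 != 0 by apply: contraNneq qn0 => h; rewrite (deriv_eq0 q'0) h.
rewrite (deriv_eq0 p'0) (deriv_eq0 q'0) !coefC /=.
apply: (canLR (mulfK _)); first by rewrite tofrac_eq0 polyC_eq0.
by rewrite -tofracM -polyCM divfK.
Qed.

(** Write Q = U J V by Gaussian elimination. Idempotence gives J V U J = J, so U conjugates Q to J V
    U = J + Z with Z J = 0 and Z^2 = 0; the extra factor 1 - Z removes Z. *)
Lemma idempotent_conj (C : fieldType) n (Q : 'M[C]_n) : Q *m Q = Q ->
  exists2 P, P \in unitmx & Q *m P = P *m pid_mx (\rank Q).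
Proof.
move=> QQ; set r := \rank Q; set J : 'M[C]_n := pid_mx r.
pose U := col_ebase Q; pose V := row_ebase Q.
have QE : Q = U *m J *m V by rewrite mulmx_ebase.
have [uU uV] : U \in unitmx /\ V \in unitmx.
  by rewrite col_ebase_unit row_ebase_unit.
have JJ : J *m J = J by rewrite pid_mx_id // rank_leq_row.
have JVUJ : J *m V *m U *m J = J.
  apply: (can_inj (mulKmx uU)); apply: (can_inj (mulmxK uV)).
  by rewrite -QE -[RHS]QQ [in RHS]QE !mulmxA.
pose Z := J *m V *m U *m (1%:M - J).
have ZZ : Z *m Z = 0.
  rewrite /Z !mulmxA -(mulmxA _ (1%:M - J) J) mulmxBl mul1mx JJ subrr.
  by rewrite mulmx0 !mul0mx.
exists (U *m (1%:M - Z)).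
  rewrite unitmx_mul uU.
  suff : (1%:M - Z) *m (1%:M + Z) = 1%:M by case/mulmx1_unit.
  by rewrite mulmxDr mulmx1 mulmxBl mul1mx ZZ subr0 subrK.
have ZJ : Z *m J = 0 by rewrite /Z -mulmxA mulmxBl mul1mx JJ subrr mulmx0.
rewrite -[RHS]mulmxA mulmxBl mul1mx ZJ subr0 QE.
rewrite -!mulmxA; congr (U *m _); rewrite !mulmxA mulmxBr mulmx1.
rewrite /Z !mulmxA JVUJ mulmxBr mulmx1 -{1 2}[J *m V *m U]mulmx1.
by rewrite -mulmxBr -mulmxBr opprB addrCA subrr addr0.
Qed.

Section TwoByTwo.
Variable R : comNzRingType.

Lemma mx2E (A : 'M[R]_(1 + 1)) :
  A = mx2 (A (lshift 1 0) (lshift 1 0)) (A (lshift 1 0) (rshift 1 0))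
          (A (rshift 1 0) (lshift 1 0)) (A (rshift 1 0) (rshift 1 0)).
Proof.
rewrite -[LHS]submxK /mx2; congr block_mx;
  by apply/matrixP=> i j; rewrite !mxE !ord1 mulr1n.
Qed.

Lemma det_mx2 (a b c d : R) : \det (mx2 a b c d) = a * d - b * c.
Proof.
have i0 : ord0 = lshift 1 0 :> 'I_(1 + 1) by apply: val_inj.
have i1 : lift ord0 ord0 = rshift 1 0 :> 'I_(1 + 1) by apply: val_inj.
have i1' : lift (lift ord0 ord0) ord0 = lshift 1 0 :> 'I_(1 + 1) by apply: val_inj.
rewrite (expand_det_row _ ord0) !big_ord_recl big_ord0 /cofactor !det_mx11 !mxE.
rewrite !i1' !i1 !i0 /mx2 /=.
rewrite (unsplitK (inl _ : 'I_1 + 'I_1)) (unsplitK (inr _ : 'I_1 + 'I_1)) !mxE.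
rewrite !(unsplitK (inl _ : 'I_1 + 'I_1)) !(unsplitK (inr _ : 'I_1 + 'I_1)) !mxE !mulr1n.
by rewrite addr0 expr1; ring.
Qed.

End TwoByTwo.

Section Eigenvalues.
Variable R : realType.

Lemma mu_neq0 : Num.sqrt (6 * Num.sqrt 5 - 10) / 2 != 0 :> R.
Proof.
have s5 : Num.sqrt 5 ^+ 2 = 5 :> R by rewrite sqr_sqrtr // ler0n.
have s0 : 0 <= Num.sqrt 5 :> R by exact: sqrtr_ge0.
rewrite mulf_neq0 ?invr_neq0 ?pnatr_eq0 // sqrtr_eq0 -ltNge.
by rewrite expr2 in s5; nra.
Qed.

Lemma nu_neq0 : Num.sqrt (6 * Num.sqrt 5 + 10) / 2 != 0 :> R.
Proof.
have s0 : 0 <= Num.sqrt 5 :> R by exact: sqrtr_ge0.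
rewrite mulf_neq0 ?invr_neq0 ?pnatr_eq0 // sqrtr_eq0 -ltNge.
by lra.
Qed.

Lemma lambda2_neq0 : lambda2 R != 0.
Proof.
by apply/eqP => -[/eqP]; rewrite (negPf mu_neq0).
Qed.

Lemma lambda4_neq0 : lambda4 R != 0.
Proof.
by apply/eqP => -[/eqP]; rewrite (negPf nu_neq0).
Qed.

(* One eigenvalue is purely imaginary and the other one is real. *)
Lemma lambda_indep (y z : int) :
  lambda2 R * y%:~R + lambda4 R * z%:~R = 0 -> y = 0 /\ z = 0.
Proof.
have intC (t : int) : t%:~R = Complex (t%:~R : R) 0 by rewrite -(rmorph_int (real_complex R)).
rewrite !intC /lambda2 /lambda4 => -[] /=.
rewrite !(mul0r, mulr0, subr0, addr0, oppr0, add0r) => /eqP + /eqP.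
rewrite [_ * z%:~R == 0]mulf_eq0 [_ * y%:~R == 0]mulf_eq0.
by rewrite (negPf mu_neq0) (negPf nu_neq0) /= !intr_eq0 => /eqP-> /eqP->.
Qed.

End Eigenvalues.

(** The sizes 4 and 1 + 1 + (1 + 1) are convertible, so the two descriptions are compared without a
    cast. *)
Lemma matrix4E (T : comNzRingType) (a b c d a' b' c' d' : T) :
  \matrix_(i < 4, j < 4) nth 0 (nth [::]
    [:: [:: a; b; 0; 0]; [:: c; d; 0; 0]; [:: 0; 0; a'; b']; [:: 0; 0; c'; d']] i) j
  = block_mx (mx2 a b c d) 0 0 (mx2 a' b' c' d').
Proof.
apply/(@matrixP _ (1 + 1 + (1 + 1)) (1 + 1 + (1 + 1)))=> i j; rewrite mxE.
case: (@split_ordP (1 + 1) (1 + 1) i) => i1 ->; case: (@split_ordP (1 + 1) (1 + 1) j) => j1 ->;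
  case: (@split_ordP 1 1 i1) => i2 ->; case: (@split_ordP 1 1 j1) => j2 ->;
  rewrite !ord1 ?block_mxEul ?block_mxEur ?block_mxEdl ?block_mxEdr /mx2 /=;
  rewrite ?block_mxEul ?block_mxEur ?block_mxEdl ?block_mxEdr ?mxE ?mulr1n //.
Qed.

Lemma scaled_systemE (E : fieldType) (t l1 l2 l3 l4 : E) : t != 0 ->
  let s := t ^- 6 in
  t *: (t ^+ 5 *: \matrix_(i < 4, j < 4) nth 0 (nth [::]
    [:: [:: l1 + 3 * s; - s; 0; 0];
        [:: - s; l2 + 3 * s; 0; 0];
        [:: 0; 0; l3 + 3 * s; - s];
        [:: 0; 0; - s; l4 + 3 * s]] i) j) =
  block_mx (mx2 (3 + l1 * t ^+ 6) (- 1) (- 1) (3 + l2 * t ^+ 6)) 0 0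
           (mx2 (3 + l3 * t ^+ 6) (- 1) (- 1) (3 + l4 * t ^+ 6)).
Proof.
move=> t0 s; rewrite scalerA -exprS.
apply: etrans (congr1 (fun X : 'M_(1 + 1 + (1 + 1)) => t ^+ 6 *: X)
  (matrix4E _ _ _ _ _ _ _ _)) _.
rewrite /= scale_block_mx !scaler0 !mx2Z /s.
by congr (block_mx (mx2 _ _ _ _) _ _ (mx2 _ _ _ _)); field.
Qed.

(** * The Galois group of the system is conjugate to SL2 x SL2 *)

Section GaloisGroup.
Variable R : realType.
Local Notation C := R[i].
Local Notation K := (ratfun C).
Variables (L : fieldType) (dL : derivation L) (io : {rmorphism K -> L}).
Variable F : 'M[L]_(1 + 1 + (1 + 1)).
Hypothesis hPV : picard_vessiot (ratfun_der C)
  (ratfun_tau C ^+ 5 *: system_mx R) dL io F.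

Definition cst : {rmorphism C -> K} := @tofrac {poly C} \o polyC.
Definition constL : {rmorphism C -> L} := io \o cst.

Local Notation tau := (ratfun_tau C).

Lemma tau_neq0 : tau != 0.
Proof. by rewrite tofrac_eq0 polyX_eq0. Qed.

Definition tdL : derivation L := scale_der dL (io tau).

Lemma tau_system_mx : tau *: (tau ^+ 5 *: system_mx R) = pair_mx (lambda2 R) (lambda4 R).
Proof.
have t0 := tau_neq0.
have l1 : ratfun_cst (lambda1 R) = - ratfun_cst (lambda2 R).
  have -> : lambda1 R = - lambda2 R.
    by apply/eqP; rewrite eq_complex /= oppr0 !eqxx.
  exact: (rmorphN cst).
have l3 : ratfun_cst (lambda3 R) = - ratfun_cst (lambda4 R).
  have -> : lambda3 R = - lambda4 R.
    by apply/eqP; rewrite eq_complex /= oppr0 !eqxx.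
  exact: (rmorphN cst).
rewrite /system_mx (scaled_systemE _ _ _ _ tau_neq0) l1 l3 /pair_mx /block_mx_of.
by rewrite !mulNr.
Qed.

Lemma solF : map_mx tdL F = map_mx io (pair_mx (lambda2 R) (lambda4 R)) *m F.
Proof.
rewrite -tau_system_mx map_mxZ -scalemxAl -(pv_sol hPV).
by apply/matrixP=> i j; rewrite !mxE.
Qed.

Lemma io_theta x : tdL (io x) = io (r_theta C x).
Proof. by rewrite /= (pv_der hPV) -rmorphM. Qed.

Lemma constant_ext x : tdL x = 0 -> exists c, x = constL c.
Proof.
move=> /eqP; rewrite mulf_eq0 fmorph_eq0 (negPf tau_neq0) /= => /eqP x0.
have [a a0 ->] := pv_cst hPV x0; have [c ->] := ratfun_constant a0.
by exists c.
Qed.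

Lemma constant_mx n (X : 'M[L]_n) :
  map_mx tdL X = 0 -> exists Y, X = map_mx constL Y.
Proof.
move=> X0; have cX i j : exists c, X i j = constL c.
  by apply: constant_ext; have /matrixP/(_ i j) := X0; rewrite !mxE.
exists (\matrix_(i, j) sval (cid (cX i j))); apply/matrixP=> i j.
by rewrite !mxE; exact: svalP (cid (cX i j)).
Qed.

Lemma tdL_const n (Y : 'M[C]_n) : map_mx tdL (map_mx constL Y) = 0.
Proof.
apply/matrixP=> i j; rewrite !mxE -[constL _]/(io (ratfun_cst _)) io_theta.
rewrite -[r_theta C _]/(tau * ratfun_der C (tofrac _)) ratfun_der_poly derivC.
by rewrite !rmorph0 mulr0 rmorph0.
Qed.

Definition idem (T : pzRingType) : 'M[T]_(1 + 1 + (1 + 1)) := block_mx 1%:M 0 0 0.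

Lemma idem_map (T T' : pzRingType) (f : {rmorphism T -> T'}) :
  map_mx f (idem T) = idem T'.
Proof. by rewrite /idem map_block_mx map_mx1 !map_mx0. Qed.

Lemma idem_comm (T : pzRingType) (X : 'M[T]_(1 + 1 + (1 + 1))) :
  idem T *m X = X *m idem T ->
  X = block_mx (ulsubmx X) 0 0 (drsubmx X).
Proof.
rewrite -{1 2 3}[X]submxK /idem !mulmx_block !(mul1mx, mul0mx, mulmx1, mulmx0).
by rewrite !addr0 => /eq_block_mx[_ -> <- _].
Qed.

Lemma idem_block (T : pzRingType) (A B : 'M[T]_(1 + 1)) :
  idem T *m block_mx A 0 0 B = block_mx A 0 0 B *m idem T.
Proof.
by rewrite /idem !mulmx_block !(mul1mx, mul0mx, mulmx1, mulmx0) !addr0.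
Qed.

Lemma pid_idem : pid_mx 2 = idem C.
Proof.
rewrite /idem -pid_mx_1; apply/(@matrixP _ (1 + 1 + (1 + 1)) (1 + 1 + (1 + 1)))=> i j.
case: (@split_ordP (1 + 1) (1 + 1) i) => i1 ->; case: (@split_ordP (1 + 1) (1 + 1) j) => j1 ->.
- by rewrite block_mxEul !mxE.
- rewrite block_mxEur !mxE /=; have lt := ltn_ord i1.
  by have /negPf -> : (nat_of_ord i1 != 1 + 1 + j1)%N by lia.
- rewrite block_mxEdl !mxE /=; have lt := ltn_ord j1.
  by have /negPf -> : (1 + 1 + i1 != nat_of_ord j1)%N by lia.
- by rewrite block_mxEdr !mxE /= ltnNge leq_addr andbF.
Qed.

Lemma unitF : F \in unitmx. Proof. exact: pv_unit hPV. Qed.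

(** F is an arbitrary fundamental matrix, not a block diagonal one. The block projector e commutes
    with the system, so F^-1 e F is a constant idempotent of rank 2; a constant change of basis P
    makes it equal to e, and then F P commutes with e. *)
Lemma splitting : exists2 P : 'M[C]_(1 + 1 + (1 + 1)), P \in unitmx &
  exists Fa Fd, F *m map_mx constL P = block_mx Fa 0 0 Fd.
Proof.
have uF := unitF.
pose X := invmx F *m idem L *m F.
have FX : F *m X = idem L *m F by rewrite /X !mulmxA mulmxV // mul1mx.
have [Q QE] : exists Q, X = map_mx constL Q.
  apply: constant_mx; apply: (can_inj (mulKmx uF)); rewrite mulmx0.
  have dE : map_mx tdL (idem L) = 0.
    by rewrite -(idem_map constL) tdL_const.
  have := congr1 (fun Y : 'M_(1 + 1 + (1 + 1)) => map_mx tdL Y) FX.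
  rewrite /= !(map_derM (@derD _ tdL) (@derM _ tdL)) dE mul0mx add0r solF.
  have cM : idem L *m map_mx io (pair_mx (lambda2 R) (lambda4 R)) =
            map_mx io (pair_mx (lambda2 R) (lambda4 R)) *m idem L.
    by rewrite /pair_mx map_block_mx !map_mx0 idem_block.
  by rewrite -(mulmxA _ F X) FX [RHS]mulmxA cM -[RHS]mulmxA => /(canRL (addKr _)); rewrite addNr.
have QQ : Q *m Q = Q.
  apply: (map_mx_inj (f := constL)); rewrite map_mxM -QE /X !mulmxA.
  rewrite -(mulmxA _ F (invmx F)) mulmxV // mulmx1.
  congr (_ *m _); rewrite -mulmxA; congr (_ *m _).
  by rewrite /idem mulmx_block !(mul1mx, mul0mx, mulmx0) !addr0.
have rQ : \rank Q = 2.
  rewrite -(mxrank_map constL) -QE /X mxrankMfree ?row_free_unit // .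
  rewrite -mxrank_tr trmx_mul mxrankMfree; last by rewrite row_free_unit unitmx_tr unitmx_inv.
  by rewrite mxrank_tr -(idem_map constL) mxrank_map -pid_idem rank_pid_mx.
have [P uP QP] := idempotent_conj QQ.
exists P => //; exists (ulsubmx (F *m map_mx constL P)), (drsubmx (F *m map_mx constL P)).
apply: idem_comm; rewrite rQ pid_idem in QP.
rewrite mulmxA -FX -[RHS]mulmxA -(idem_map constL) -map_mxM -QP map_mxM -QE.
by rewrite mulmxA.
Qed.

Lemma mx2_inj (T : comNzRingType) (a b c d a' b' c' d' : T) :
  mx2 a b c d = mx2 a' b' c' d' -> [/\ a = a', b = b', c = c' & d = d'].
Proof.
have s (x y : T) : x%:M = y%:M :> 'M_1 -> x = y.
  by move=> /matrixP/(_ 0 0); rewrite !mxE !mulr1n.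
by move=> /eq_block_mx[/s-> /s-> /s-> /s->].
Qed.

(** The trace of a block is 6, so the determinant satisfies theta y = 6 y. It is therefore a
    constant times tau^6, an element of the base field that every Galois automorphism fixes. *)
Lemma det_block_base x (X : 'M[L]_(1 + 1)) :
  map_mx tdL X = map_mx io (block_mx_of x) *m X -> exists y, \det X = io y.
Proof.
rewrite (mx2E X); move: (X _ _) (X _ _) (X _ _) (X _ _) => a b c d.
rewrite !map_mx2 ?rmorph0 ?(der0 tdL) // mx2M => /mx2_inj[].
rewrite rmorphN1; set l := io (3 - _); set l' := io (3 + _).
have ll : l + l' = 6.
  rewrite /l /l' -rmorphD -[RHS](rmorph_nat io); congr (io _).
  by move: (_ * _) => z; rewrite addrACA addNr addr0 -natrD.
move=> ea eb ec ed; rewrite det_mx2.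
have t0 : io tau ^+ 6 != 0 by rewrite expf_neq0 // fmorph_eq0 tau_neq0.
have dt : tdL (io tau ^+ 6) = 6 * io tau ^+ 6.
  rewrite (derXn tdL) io_theta -[r_theta C _]/(tau * ratfun_der C (tofrac 'X)).
  by rewrite ratfun_der_poly derivX rmorph1 mulr1 -mulrA -exprSr.
have dd : tdL (a * d - b * c) = 6 * (a * d - b * c).
  rewrite (derB tdL) !(derM tdL) ea eb ec ed -ll; ring.
have [y yE] : exists y, (a * d - b * c) / io tau ^+ 6 = constL y.
  apply: constant_ext; rewrite (der_div tdL) // dd dt.
  by rewrite [X in _ - X]mulrCA [X in _ - X]mulrA subrr mul0r.
exists (cst y * tau ^+ 6); rewrite rmorphM rmorphXn -[io (cst y)]/(constL y) -yE.
by rewrite divfK // [d * a]mulrC [c * b]mulrC.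
Qed.

Lemma pval_det f X (A D : 'M[L]_(1 + 1)) :
  map_mx tdL X = map_mx io (pair_mx (lambda2 R) (lambda4 R)) *m X ->
  \det A = 1 -> \det D = 1 -> pval io f X = 0 ->
  pval io f (block_mx A 0 0 D *m X) = 0.
Proof.
rewrite (mx2E A) (mx2E D) !det_mx2 => sX dA dD fX.
exact: (pval_sl2 (lambda2_neq0 R) (lambda4_neq0 R) (@lambda_indep R) io_theta sX fX).
Qed.

Lemma unitmx_block (T : comUnitRingType) (A D : 'M[T]_(1 + 1)) :
  (block_mx A 0 0 D \in unitmx) = (A \in unitmx) && (D \in unitmx).
Proof. by rewrite !unitmxE det_ublock unitrM. Qed.

Section Split.
Variable P : 'M[C]_(1 + 1 + (1 + 1)).
Hypothesis uP : P \in unitmx.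
Variables Fa Fd : 'M[L]_(1 + 1).
Hypothesis FP : F *m map_mx constL P = block_mx Fa 0 0 Fd.

Local Notation G := (diff_galois_group dL io F).

Lemma unit_blocks : Fa \in unitmx /\ Fd \in unitmx.
Proof.
by apply/andP; rewrite -unitmx_block -FP unitmx_mul unitF map_unitmx.
Qed.

Lemma sol_blocks : map_mx tdL Fa = map_mx io (block_mx_of (lambda2 R)) *m Fa /\
  map_mx tdL Fd = map_mx io (block_mx_of (lambda4 R)) *m Fd.
Proof.
have := congr1 (fun X : 'M_(1 + 1 + (1 + 1)) => map_mx tdL X) FP.
rewrite /= (map_derM (@derD _ tdL) (@derM _ tdL)) tdL_const mulmx0 addr0 solF.
rewrite -mulmxA FP /pair_mx.
move: (block_mx_of (lambda2 R)) (block_mx_of (lambda4 R)) => B1 B2.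
rewrite (map_block_mx _ B1) map_block_mx !map_mx0 mulmx_block.
by rewrite !mul0mx !mulmx0 !addr0 !add0r => /eq_block_mx[-> _ _ ->].
Qed.

(** An automorphism keeps F P block diagonal, so the conjugated matrix is block diagonal too; each
    block has determinant 1 because the determinant of [Fa] or [Fd] is fixed. *)
Lemma galois_sub M : G M ->
  group_prod (@SL C (1 + 1)) (@SL C (1 + 1)) (invmx P *m M *m P).
Proof.
case=> s [_ _ sK] sM.
have [M' M'P] : exists M', M' = invmx P *m M *m P by eexists.
rewrite -M'P.
have sC n (Y : 'M[C]_n) : map_mx s (map_mx constL Y) = map_mx constL Y.
  by apply/matrixP=> i j; rewrite !mxE sK.
have {}sM : map_mx s F = F *m map_mx constL M := sM.
have [uFa uFd] := unit_blocks; have [sFa sFd] := sol_blocks.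
have E : block_mx (map_mx s Fa) 0 0 (map_mx s Fd) =
    block_mx Fa 0 0 Fd *m map_mx constL M'.
  rewrite -FP -mulmxA -map_mxM M'P !mulmxA mulmxV // mul1mx map_mxM mulmxA -sM.
  by rewrite -[in RHS](sC _ P) -map_mxM FP map_block_mx !map_mx0.
have uB : block_mx Fa 0 0 Fd \in unitmx by rewrite unitmx_block uFa.
have cM : idem C *m M' = M' *m idem C.
  apply: (map_mx_inj (f := constL)); rewrite !map_mxM idem_map.
  apply: (can_inj (mulKmx uB)); rewrite !mulmxA -idem_block -(mulmxA (idem L)) -E.
  exact: idem_block.
have M'E := idem_comm cM; move: E; rewrite M'E map_block_mx !map_mx0 mulmx_block.
rewrite !(mul0mx, mulmx0) !addr0 !add0r => /eq_block_mx[eA _ _ eD].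
have SLb x (X : 'M[L]_(1 + 1)) Y : X \in unitmx ->
    map_mx tdL X = map_mx io (block_mx_of x) *m X ->
    map_mx s X = X *m map_mx constL Y -> \det Y = 1.
  move=> uX /det_block_base[y yE] /(congr1 (fun Z : 'M_(1 + 1) => \det Z)) /=.
  rewrite det_map_mx det_mulmx det_map_mx yE sK -[LHS]mulr1 => /mulfI e.
  apply: (fmorph_inj constL); rewrite rmorph1 -e // -yE.
  by rewrite -unitfE -unitmxE.
exists (ulsubmx M'); first exact: SLb uFa sFa eA.
by exists (drsubmx M') => //; exact: SLb uFd sFd eD.
Qed.

(** F M is F multiplied on the left by a block matrix of determinants 1 over L, so F and F M satisfy
    the same relations; the converse direction uses the inverse blocks. *)
Lemma galois_sup M :
  group_prod (@SL C (1 + 1)) (@SL C (1 + 1)) (invmx P *m M *m P) -> G M.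
Proof.
case=> A dA [D dD ME]; have [uFa uFd] := unit_blocks.
have uA : A \in unitmx by rewrite unitmxE dA unitr1.
have uD : D \in unitmx by rewrite unitmxE dD unitr1.
have uM : M \in unitmx.
  have : block_mx A 0 0 D \in unitmx by rewrite unitmx_block uA.
  by rewrite ME !unitmx_mul => /andP[/andP[]].
have FM : F *m map_mx constL M = block_mx (Fa *m map_mx constL A *m invmx Fa) 0 0
    (Fd *m map_mx constL D *m invmx Fd) *m F.
  have uP' : map_mx constL P \in unitmx by rewrite map_unitmx.
  apply: (can_inj (mulmxK uP')); rewrite -[RHS]mulmxA FP -(mulmxA F) -map_mxM.
  have -> : M *m P = P *m block_mx A 0 0 D by rewrite ME !mulmxA mulmxV // mul1mx.
  rewrite map_mxM mulmxA FP map_block_mx !map_mx0 !mulmx_block.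
  by rewrite !(mul0mx, mulmx0) !addr0 !add0r !mulmxKV.
have dconj (X : 'M[L]_(1 + 1)) (Y : 'M[C]_(1 + 1)) : X \in unitmx ->
    \det Y = 1 -> \det (X *m map_mx constL Y *m invmx X) = 1.
  move=> uX dY; rewrite !det_mulmx det_map_mx dY rmorph1 mulr1 det_inv.
  by rewrite mulrV // -unitmxE.
set gA := Fa *m _ *m _ in FM; set gD := Fd *m _ *m _ in FM.
have [dgA dgD] : \det gA = 1 /\ \det gD = 1 by split; apply: dconj.
have solFM : map_mx tdL (F *m map_mx constL M) =
    map_mx io (pair_mx (lambda2 R) (lambda4 R)) *m (F *m map_mx constL M).
  rewrite (map_derM (@derD _ tdL) (@derM _ tdL)) tdL_const mulmx0 addr0 solF.
  by rewrite mulmxA.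
have ME' : map_mx io (map_mx cst M) = map_mx constL M.
  by apply/matrixP=> i j; rewrite !mxE.
have uN : map_mx cst M \in unitmx by rewrite map_unitmx.
have dN : map_mx (ratfun_der C) (map_mx cst M) = 0.
  apply/matrixP=> i j; rewrite !mxE -[cst _]/(tofrac _) ratfun_der_poly derivC.
  by rewrite rmorph0.
have rel f : pval io f F = 0 <-> pval io f (F *m map_mx io (map_mx cst M)) = 0.
  rewrite ME'; split=> fF; first by rewrite FM; apply: pval_det => //; exact: solF.
  have uI (Y : 'M[L]_(1 + 1)) : \det Y = 1 -> \det (invmx Y) = 1.
    by move=> dY; rewrite det_inv dY invr1.
  have -> : F = block_mx (invmx gA) 0 0 (invmx gD) *m (F *m map_mx constL M).
    rewrite FM mulmxA mulmx_block !mul0mx !mulmx0 !addr0 !add0r.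
    by rewrite !mulVmx ?unitmxE ?dgA ?dgD ?unitr1 // -scalar_mx_block mul1mx.
  by apply: pval_det => //; apply: uI.
have [s ds sF] := automorphism_of_relations hPV uN dN rel.
by exists s => //; rewrite sF ME'.
Qed.

End Split.

End GaloisGroup.

(** * Zariski connectedness *)

Section ZariskiConnectedness.
Variables (C : numFieldType) (n : nat).
Local Open Scope classical_set_scope.

Definition arc_at (g : 'M[{poly C}]_n) (t : C) : 'M[C]_n := map_mx (horner_eval t) g.

Definition arc_poly (p : mpoly (n * n) C) (g : 'M[{poly C}]_n) : {poly C} :=
  \sum_(m <- msupp p) (mcoeff m p)%:P * \prod_i mxvec g 0 i ^+ m i.

Lemma arc_polyE p g t : (arc_poly p g).[t] = mxeval p (arc_at g t).
Proof.
rewrite /mxeval mevalE horner_sum; apply: eq_bigr => m _.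
rewrite hornerM hornerC horner_prod; congr (_ * _); apply: eq_bigr => i _.
by rewrite horner_exp; case/mxvec_indexP: i => i k; rewrite !mxvecE mxE.
Qed.

(** If a nonempty relatively clopen part missed the end of an arc, some p would be nonzero at its
    start and some r at its end, while p r vanished along it. This contradicts the absence of zero
    divisors among polynomials in the parameter. *)
Lemma arc_connected (A : set (zariski_mx C n)) :
  (forall x y, A x -> A y -> exists g, [/\ arc_at g 0 = x, arc_at g 1 = y &
     forall t, A (arc_at g t)]) -> connected A.
Proof.
move=> arcs B [x Bx] [U [S ->] BU] [V /zariski_closedP[T ->] BV].
have [Ax Ux] : (A `&` ~` zero_locus S) x by rewrite -BU.
apply/seteqP; split=> [y|y Ay]; first by rewrite BU => -[].
apply: contrapT => nBy.
have [g [gx gy gA]] := arcs x y Ax Ay.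
have [p [Sp px]] : exists p, S p /\ mxeval p x <> 0.
  apply: contrapT => h; apply: Ux => p Sp; apply: contrapT => px.
  by apply: h; exists p.
have [r [Tr ry]] : exists r, T r /\ mxeval r y <> 0.
  apply: contrapT => h; apply: nBy; rewrite BV; split=> // r Tr.
  by apply: contrapT => ry; apply: h; exists r.
have p0 : arc_poly p g != 0.
  by apply/eqP => e; apply: px; rewrite -gx -arc_polyE e horner0.
have r0 : arc_poly r g != 0.
  by apply/eqP => e; apply: ry; rewrite -gy -arc_polyE e horner0.
have : arc_poly p g * arc_poly r g = 0.
  apply: poly_nat_eq0 => k; rewrite hornerM !arc_polyE.
  have [|nB] := pselect (B (arc_at g k%:R)).
    by rewrite BV => -[_ /(_ r Tr) ->]; rewrite mulr0.
  suff -> : mxeval p (arc_at g k%:R) = 0 by rewrite mul0r.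
  apply: contrapT => h; apply: nB; rewrite BU; split; first exact: gA.
  by move=> /(_ p Sp).
by move/eqP; rewrite mulf_eq0 (negPf p0) (negPf r0).
Qed.

Lemma conj_regular (G : set 'M[C]_n) (U V : 'M[C]_n) i j :
  regular_on G (fun M => (U *m M *m V) i j).
Proof.
exists (\sum_a \sum_b mpolyC _ (U i b * V a j) *
   mpolyX C (mnm1 (mxvec_index b a))), 0%N => M _.
rewrite expr0 divr1 /mxeval rmorph_sum mxE; apply: eq_bigr => a _.
rewrite rmorph_sum mxE mulr_suml; apply: eq_bigr => b _ /=.
by rewrite mevalM mevalC mevalXU mxvecE mulrAC.
Qed.

End ZariskiConnectedness.

(** Multiplying the four parameters of the elementary factorisation by t deforms the identity into A
    inside SL2. *)
Lemma sl2_arc (C : numFieldType) (A : 'M[C]_(1 + 1)) : \det A = 1 ->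
  exists g, [/\ arc_at g 0 = 1%:M, arc_at g 1 = A & forall t, \det (arc_at g t) = 1].
Proof.
rewrite {1}(mx2E A) det_mx2 => /sl2_elementary[s [x [u [y e]]]].
pose g : 'M[{poly C}]_(1 + 1) := mx2 1 0 (s *: 'X) 1 *m (mx2 1 (x *: 'X) 0 1 *m
   (mx2 1 0 (u *: 'X) 1 *m mx2 1 (y *: 'X) 0 1)).
have gE t : arc_at g t = mx2 1 0 (s * t) 1 *m (mx2 1 (x * t) 0 1 *m
   (mx2 1 0 (u * t) 1 *m mx2 1 (y * t) 0 1)).
  rewrite /arc_at /g !map_mxM !map_mx2 ?rmorph0 // /= rmorph1.
  by rewrite /horner_eval !hornerZ hornerX.
exists g; split.
- by rewrite gE !mulr0 mx2_1 !mul1mx.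
- by rewrite gE !mulr1 -e -mx2E.
- move=> t; rewrite gE !det_mulmx !det_mx2.
  by rewrite !(mulr0, mul0r, mulr1, subr0).
Qed.

Section ConjugateProduct.
Variables (C : numFieldType) (P : 'M[C]_(1 + 1 + (1 + 1))).
Hypothesis uP : P \in unitmx.
Variable G : set 'M[C]_(1 + 1 + (1 + 1)).
Hypothesis GE : forall M, G M <->
  group_prod (@SL C (1 + 1)) (@SL C (1 + 1)) (invmx P *m M *m P).
Local Open Scope classical_set_scope.

Lemma conj_connected : connected (G : set (zariski_mx C _)).
Proof.
apply: arc_connected => M N /GE[A dA [D dD ME]] /GE[A' dA' [D' dD' NE]].
have [uA uD] : A \in unitmx /\ D \in unitmx by rewrite !unitmxE dA dD unitr1.
have dV (X Y : 'M[C]_(1 + 1)) : \det X = 1 -> \det Y = 1 -> \det (invmx X *m Y) = 1.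
  by move=> dX dY; rewrite det_mulmx det_inv dX dY invr1 mulr1.
have [g [g0 g1 gd]] := sl2_arc (dV _ _ dA dA').
have [h [h0 h1 hd]] := sl2_arc (dV _ _ dD dD').
(* An arc from the identity to the quotient of the two points, blockwise, translated by the first
   point and conjugated by P. *)
pose k : 'M[{poly C}]_(1 + 1 + (1 + 1)) := map_mx polyC (P *m block_mx A 0 0 D) *m
   block_mx g 0 0 h *m map_mx polyC (invmx P).
have cE (t : C) m (X : 'M[C]_m) : map_mx (horner_eval t) (map_mx polyC X) = X.
  by apply/matrixP=> a b; rewrite !mxE /horner_eval hornerC.
have kE t : arc_at k t = P *m block_mx (A *m arc_at g t) 0 0 (D *m arc_at h t) *m invmx P.
  rewrite /arc_at /k !(map_mxM (horner_eval t)) !cE map_block_mx !map_mx0.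
  rewrite -(mulmxA P (block_mx A 0 0 D)) mulmx_block.
  by rewrite !mul0mx !mulmx0 !addr0 !add0r.
have back X : X = P *m (invmx P *m X *m P) *m invmx P.
  by rewrite !mulmxA mulmxV // mul1mx -mulmxA mulmxV // mulmx1.
exists k; split.
- by rewrite kE g0 h0 !mulmx1 ME -back.
- by rewrite kE g1 h1 !mulmxA !mulmxV // !mul1mx [RHS]back -NE.
- move=> t; apply/GE; rewrite kE.
  exists (A *m arc_at g t); first by rewrite /SL /= det_mulmx dA gd mulr1.
  exists (D *m arc_at h t); first by rewrite /SL /= det_mulmx dD hd mulr1.
  by rewrite !mulmxA mulVmx // mul1mx mulmxKV.
Qed.

Lemma conj_identity_component : identity_component G = G.
Proof.
apply/seteqP; split=> [M|M GM]; first by apply: connected_component_sub.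
exists (G : set (zariski_mx C _)) => //; split=> //; last exact: conj_connected.
apply/GE; rewrite mulmx1 mulVmx //; exists 1%:M; first exact: det1.
by exists 1%:M; [exact: det1|rewrite -scalar_mx_block].
Qed.

Lemma conj_iso :
  alg_group_iso (identity_component G) (group_prod (@SL C (1 + 1)) (@SL C (1 + 1))).
Proof.
rewrite conj_identity_component.
exists (fun M => invmx P *m M *m P), (fun N => P *m N *m invmx P); split.
- split=> [M /GE //|M N _ _|i j]; last exact: conj_regular.
  by rewrite !mulmxA mulmxK.
- split=> [N GN|M N _ _|i j]; last exact: conj_regular.
  + by apply/GE; rewrite !mulmxA mulVmx // mul1mx mulmxKV.
  + by rewrite !mulmxA mulmxKV.
- by move=> M _; rewrite !mulmxA mulmxV // mul1mx mulmxK.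
- by move=> N _; rewrite !mulmxA mulVmx // mul1mx mulmxKV.
Qed.

End ConjugateProduct.

Theorem proposition3p4 (R : realType)
  (L : fieldType) (dL : derivation L)
  (iota : {rmorphism ratfun R[i] -> L}) (F : 'M[L]_4)
  (hPV : picard_vessiot (ratfun_der R[i])
           (ratfun_tau R[i] ^+ 5 *: system_mx R) dL iota F) :
  alg_group_iso
    (identity_component (diff_galois_group dL iota F))
    (group_prod (@SL R[i] 2) (@SL R[i] 2)).
Proof.
have [P uP [Fa [Fd FP]]] := splitting hPV.
apply: (@conj_iso _ P uP (diff_galois_group dL iota F)) => M.
by split; [exact: galois_sub FP _|exact: galois_sup FP _].
Qed.
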